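(* Let $\{X,X_n;\,n\ge1\}$ be a sequence of non-negative i.i.d. random variables, $S_n=\sum_{i=1}^nX_i$, and let $$\bar\alpha=-\limsup_{t\to\infty}\frac1t\log\mathbb{P}(\log X>t),\qquad \underline\alpha=-\liminf_{t\to\infty}\frac1t\log\mathbb{P}(\log X>t).$$ (i) If $0<p<1$ and $\lim_{n\to\infty}n\mathbb{P}(X>n^{1/p})=0$, then for all $s>0$, $$\limsup_{n\to\infty}\frac{1}{\log n}\log\mathbb{P}(S_n>sn^{1/p})=-\frac{\bar\alpha-p}{p},\qquad \liminf_{n\to\infty}\frac{1}{\log n}\log\mathbb{P}(S_n>sn^{1/p})=-\frac{\underline\alpha-p}{p};$$ hence, for all $s>0$ and $\hat\alpha\in[0,\infty]$, $\lim_{n\to\infty}\frac{1}{\log n}\log\mathbb{P}(S_n>sn^{1/p})=-(\hat\alpha-p)/p$ iff $\bar\alpha=\underline\alpha=\hat\alpha$. (ii) If $1\le p<2$, $\mathbb{E}X=\mu\in(0,\infty)$ and $\lim_{n\to\infty}n\mathbb{P}(X>n^{1/p})=0$, then for all $s>0$, $$\limsup_{n\to\infty}\frac{1}{\log n}\log\mathbb{P}(S_n>n\mu+sn^{1/p})=-\frac{\bar\alpha-p}{p},\qquad \liminf_{n\to\infty}\frac{1}{\log n}\log\mathbb{P}(S_n>n\mu+sn^{1/p})=-\frac{\underline\alpha-p}{p};$$ hence, for all $s>0$ and $\hat\alpha\in[0,\infty]$, $\lim_{n\to\infty}\frac{1}{\log n}\log\mathbb{P}(S_n>n\mu+sn^{1/p})=-(\hat\alpha-p)/p$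 iff $\bar\alpha=\underline\alpha=\hat\alpha$.
   Context: Conventions: $\log 0=-\infty$ (so $\log X=-\infty$ when $X=0$); $(\pm\infty+y)/x=\pm\infty$ for $x\in(0,\infty)$, $y\in\mathbb{R}$. *)

(* Defs.v *)
From HB Require Import structures.
From mathcomp Require Import all_boot all_order all_algebra.
From mathcomp Require Import all_classical all_reals all_analysis.
Set Implicit Arguments. Unset Strict Implicit. Unset Printing Implicit Defensive.
Import Order.TTheory GRing.Theory Num.Theory.
Import numFieldNormedType.Exports.
Local Open Scope classical_set_scope.
Local Open Scope ring_scope.

Section Defs.
Context {d : measure_display} {T : measurableType d} {R : realType}.
Variable P : probability T R.
Local Open Scope ereal_scope.

Definition mutually_independent (Y : nat -> {RV P >-> R}) : Prop :=
  forall (s : seq nat) (B : nat -> set R), uniq s ->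
    (forall i, measurable (B i)) ->
    P (\big[setI/setT]_(i <- s) (Y i @^-1` B i)) =
    \prod_(i <- s) P (Y i @^-1` B i).

Definition identically_distributed (Y : nat -> {RV P >-> R}) : Prop :=
  forall n (B : set R), measurable B ->
    P (Y n @^-1` B) = P (Y 0%N @^-1` B).

Definition iid (Y : nat -> {RV P >-> R}) : Prop :=
  mutually_independent Y /\ identically_distributed Y.

(* t |-> (1/t) log P(log X > t), with log 0 = -oo (lne) *)
Definition log_tail_rate (X : {RV P >-> R}) (t : R) : \bar R :=
  ((t^-1)%R)%:E * lne (P [set w | t%:E < lne (X w)%:E]).

Definition alpha_bar (X : {RV P >-> R}) : \bar R :=
  - limf_esup (log_tail_rate X) (pinfty_nbhs R).

Definition alpha_low (X : {RV P >-> R}) : \bar R :=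
  - limf_einf (log_tail_rate X) (pinfty_nbhs R).

Definition partial_sum (Y : nat -> {RV P >-> R}) (n : nat) (w : T) : R :=
  (\sum_(1 <= i < n.+1) Y i w)%R.

Definition log_dev_rate (Y : nat -> {RV P >-> R}) (a : nat -> R) (n : nat)
  : \bar R :=
  ((ln (n%:R : R))^-1)%:E * lne (P [set w | (a n < partial_sum Y n w)%R]).

End Defs.

(* Main.v *)
Require Import Defs.
From HB Require Import structures.
From mathcomp Require Import all_boot all_order all_algebra.
From mathcomp Require Import all_classical all_reals all_analysis.
From mathcomp Require Import measurable_realfun ring lra.
Import Order.TTheory GRing.Theory Num.Theory.
Import numFieldNormedType.Exports.
Local Open Scope classical_set_scope.
Local Open Scope ring_scope.

Set Implicit Arguments. Unset Strict Implicit. Unset Printing Implicit Defensive.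

(** Only one summand matters on the polynomial scale.  Put
    [v = ln n] and [F x = P (X > x)].  For [b < 1], truncating the summands at
    [n^(b/p)] makes the deviation of the truncated sum of order [n^(1/p)] cost
    less than any power of [n] (Chernoff with parameter [C v n^(-1/p)]), so
    [P (S_n > ...) <= n F (n^(b/p)) + n^A] for every real [A].  For [b > 1],
    exactly one summand exceeding [n^(b/p)] while the others stay near their
    mean gives [P (S_n > ...) >= n F (n^(b/p)) / 2].  Letting [b] tend to [1]
    identifies both the upper and the lower limit of the rates; the discrete
    scale [ln n] is dense enough for the continuous limits defining the tail
    exponents since [F] is monotone. *)

(** The tail hypothesis enters twice. It gives [F x = O(x^-p)], hence moments of every order [q < p]
    but possibly not of order [p]; the loss is recovered because [b < 1] makes the truncation level
    a strictly smaller power than [n^(1/p)], so that some [q] close to [p] suffices. It also gives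
    [n F (n^(b/p)) <= 1/4] for [b > 1]: double jumps then cost at most a quarter of [n F], and
    another quarter pays for the other summands being too small. The two ranges of [p] differ in the
    order of expansion of the truncated exponential moment (one for [p < 1], two with the mean
    subtracted otherwise) and in the lower bound, since [n^(b/p)] may stay below [n mu] when
    [p > 1]. The freedom in [A] is what admits the rate [-oo]: an error of fixed polynomial order
    would hide tails lighter than every power. The passage from the two inequalities to limits is
    purely analytic and is done for any nonincreasing [G], later [G t = F (expR t)]. *)

Section upper_lower_limits.
Context {T : choiceType} {X : filteredType T} {R : realType}.
Variables (F : set_system X) (FF : Filter F).
Implicit Types (f : X -> \bar R) (c : \bar R).
Local Open Scope ereal_scope.

Lemma limf_esup_lt_near f c : limf_esup f F < c -> \forall i \near F, f i < c.
Proof.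
rewrite limf_esupE => /ereal_inf_lt[_ [V FV <-]] Vc.
apply: filterS FV => i Vi; apply: le_lt_trans Vc.
by apply: ereal_sup_ubound; exists i.
Qed.

Lemma limf_esup_le_near f c : (\forall i \near F, f i <= c) -> limf_esup f F <= c.
Proof.
move=> Fc; rewrite limf_esupE.
apply: (@le_trans _ _ (ereal_sup (f @` [set i | f i <= c]))).
  by apply: ereal_inf_lbound; exists [set i | f i <= c].
by apply: ge_ereal_sup => _ [i ic <-].
Qed.

Lemma limf_einf_gt_near f c : c < limf_einf f F -> \forall i \near F, c < f i.
Proof.
rewrite /limf_einf lteNr => /limf_esup_lt_near; apply: filterS => i.
by rewrite lteN2.
Qed.

Lemma limf_einf_ge_near f c : (\forall i \near F, c <= f i) -> c <= limf_einf f F.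
Proof.
move=> Fc; rewrite /limf_einf leeNr; apply: limf_esup_le_near.
by apply: filterS Fc => i; rewrite leeN2.
Qed.

End upper_lower_limits.

(** * Affine comparison on the extended reals; rates as exponential bounds *)

Section extended_reals.
Context {R : realType}.
Implicit Types (x y : \bar R) (a b c q v : R).
Local Open Scope ereal_scope.

(** Lets later estimates use real exponents only. For [x = +oo] no [c] is available, but the bound
    is trivial; for [x = -oo] sending [c] to [-oo] forces [y = -oo]. *)
Lemma lee_affine_of_gt x y b0 b1 : (0 < b1)%R ->
  (forall c e, x < c%:E -> (0 < e)%R -> y <= (b0 + b1 * c + e)%:E) ->
  y <= b0%:E + b1%:E * x.
Proof.
move=> b1_gt0 xy; case: x xy => [r| |] xy.
- apply/lee_addgt0Pr => e e_gt0.
  have := xy (r + e / 2 / b1)%R (e / 2)%R.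
  rewrite lte_fin ltrDl !divr_gt0// => /(_ isT isT) /le_trans; apply.
  rewrite -EFinM -!EFinD lee_fin.
  have -> : (b1 * (r + e / 2 / b1) = b1 * r + e / 2)%R.
    by field; rewrite gt_eqF.
  lra.
- by rewrite mulry gtr0_sg// mul1e addey// leey.
- rewrite mulrNy gtr0_sg// mul1e addeNy.
  have y_le r : y <= r%:E.
    have := xy ((r - 1 - b0) / b1)%R 1%R (ltNyr _) ltr01.
    by rewrite mulrCA divff ?gt_eqF// mulr1 addrCA subrr addr0 subrK.
  case: y y_le {xy} => [s /(_ (s - 1)%R)|/(_ 0%R)|]//.
  by rewrite lee_fin leNgt ltrBlDr ltrDl ltr01.
Qed.

Lemma gee_affine_of_lt x y b0 b1 : (0 < b1)%R ->
  (forall c e, c%:E < x -> (0 < e)%R -> (b0 + b1 * c - e)%:E <= y) ->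
  b0%:E + b1%:E * x <= y.
Proof.
move=> b1_gt0 xy.
have -> : b0%:E + b1%:E * x = - ((- b0)%:E + b1%:E * - x).
  by rewrite [in RHS]addeC fin_num_oppeD// muleN !oppeK addeC EFinN oppeK.
rewrite leeNl; apply: lee_affine_of_gt => // c e; rewrite lteNl => xc e_gt0.
rewrite leeNl -EFinN; apply: le_trans (xy _ _ xc e_gt0).
by rewrite lee_fin; lra.
Qed.

(** Trading the logarithm for an exponential hides the value [lne 0 = -oo]: a vanishing probability
    satisfies the right-hand side too, so no case distinction is needed later. *)
Lemma rate_le v q a : (0 < v)%R ->
  ((v^-1)%:E * lne q%:E <= a%:E) = (q <= expR (a * v))%R.
Proof.
move=> v_gt0; have [q_le0|q_gt0] := leP q 0%R.
  rewrite le0_lneNy ?lee_fin// mulrNy gtr0_sg ?invr_gt0// mul1e leNye.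
  by rewrite (le_trans q_le0) ?expR_ge0.
rewrite lne_EFin// -EFinM lee_fin mulrC ler_pdivrMr//.
by rewrite -{2}(lnK q_gt0) ler_expR.
Qed.

Lemma rate_ge v q a : (0 < v)%R ->
  (a%:E <= (v^-1)%:E * lne q%:E) = (expR (a * v) <= q)%R.
Proof.
move=> v_gt0; have [q_le0|q_gt0] := leP q 0%R.
  rewrite le0_lneNy ?lee_fin// mulrNy gtr0_sg ?invr_gt0// mul1e leeNy_eq.
  by apply/esym/negbTE; rewrite -ltNge (le_lt_trans q_le0) ?expR_gt0.
rewrite lne_EFin// -EFinM lee_fin mulrC ler_pdivlMr//.
by rewrite -{2}(lnK q_gt0) ler_expR.
Qed.

Lemma limn_esup_einf_cvg (u : (\bar R)^nat) l :
  limn_esup u = l -> limn_einf u = l -> u @ \oo --> l.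
Proof.
rewrite limn_esup_lim limn_einf_lim => ul lu.
apply: (@squeeze_cvge _ _ _ _ (einfs u) _ (esups u)).
- apply: nearW => n; apply/andP; split.
  + by apply: ereal_inf_lbound; exists n => //=.
  + by apply: ereal_sup_ubound; exists n => //=.
- by rewrite -lu; exact: is_cvg_einfs.
- by rewrite -ul; exact: is_cvg_esups.
Qed.

End extended_reals.

(** * The grid of values [c * ln n] among the reals *)

Section logarithmic_scale.
Context {R : realType}.
Implicit Types (a b c e p s t : R) (n : nat).

Lemma near_ln_ge t : \forall n \near \oo, t <= ln (n%:R : R).
Proof.
near=> n; rewrite -[t]expRK ler_ln ?posrE ?expR_gt0//.
  by near: n; exact: nbhs_infty_ger.
rewrite (lt_le_trans (expR_gt0 t))//.
by near: n; exact: nbhs_infty_ger.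
Unshelve. all: by end_near. Qed.

Lemma near_scaled_ln (A : set R) c : 0 < c ->
  (\forall t \near +oo, A t) -> \forall n \near \oo, A (c * ln n%:R).
Proof.
move=> c_gt0 [M [_ AM]]; near=> n; apply: AM.
rewrite mulrC -ltr_pdivrMr// (@lt_le_trans _ _ (M / c + 1))// ?ltrDl//.
by near: n; exact: near_ln_ge.
Unshelve. all: by end_near. Qed.

Lemma trunc_double t : 1 <= t ->
  (0 < Num.trunc t)%N /\ (Num.trunc t)%:R <= t <= (Num.trunc t)%:R * 2.
Proof.
move=> t_ge1; have t_ge0 : 0 <= t by exact: le_trans t_ge1.
have /andP[tt] := trunc_itv t_ge0; rewrite -natr1 => ttS.
have t_gt0 : (0 < Num.trunc t)%N by rewrite trunc_gt0.
split=> //; rewrite tt/= (le_trans (ltW ttS))// mulr_natr mulr2n lerD2l.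
by rewrite ler1n.
Qed.

(* The two choices of [n] are twice the integer part of [expR (t / c)] and that
   integer part itself. *)
Lemma near_exp_grid (A : set nat) c : 0 < c -> (\forall n \near \oo, A n) ->
  \forall t \near +oo,
    (exists2 n, A n & t <= c * ln n%:R <= t + c * ln 2) /\
    (exists2 n, A n & t - c * ln 2 <= c * ln n%:R <= t).
Proof.
move=> c_gt0 [N _ AN]; near=> t.
pose x := expR (t / c); have x_gt0 : 0 < x by exact: expR_gt0.
have x_ge : N%:R + 1 <= x.
  apply: le_trans (expR_ge1Dx _); rewrite addrC lerD2l ler_pdivlMr//.
have x_ge1 : 1 <= x by rewrite (le_trans _ x_ge)// lerDr.
have [m_gt0 /andP[mx xm]] := trunc_double x_ge1.
have m_gt0' : 0 < (Num.trunc x)%:R :> R by rewrite ltr0n.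
have Nm : (N <= Num.trunc x)%N.
  have := xm; rewrite -(ler_nat R) => _.
  have /andP[_] := trunc_itv (ltW x_gt0); rewrite -natr1 => /(le_lt_trans x_ge).
  by rewrite ltrD2r => /ltW.
have cx : c * ln x = t by rewrite expRK mulrC divfK ?gt_eqF.
have ln2_ge0 : 0 <= ln 2 :> R by rewrite ln_ge0// ler1n.
split.
- exists (Num.trunc x * 2)%N; first by apply: AN => /=; rewrite (leq_trans Nm)// leq_pmulr.
  rewrite -cx natrM; apply/andP; split.
    by rewrite ler_pM2l// ler_ln ?posrE ?mulr_gt0.
  by rewrite -mulrDr ler_pM2l// -lnM ?posrE// ler_ln ?posrE ?mulr_gt0// ler_pM2r.
- exists (Num.trunc x); first by apply: AN.
  rewrite -cx; apply/andP; split.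
    by rewrite -mulrBr ler_pM2l// lerBlDr -lnM ?posrE// ler_ln ?posrE ?mulr_gt0.
  by rewrite ler_pM2l// ler_ln ?posrE.
Unshelve. all: by end_near. Qed.

(** Used to pick [b] near [1]: a relative change [d] of an exponent of slope [m] then costs at most
    [e / 2]. The summand [e] in the denominator of the witness covers [m = 0] and keeps [d < 1]. *)
Lemma small_slope (m e : R) : 0 < e -> exists2 d, 0 < d < 1 & `|m| * d <= e / 2.
Proof.
move=> e_gt0; exists (e / (2 * (`|m| + e))).
  have := normr_ge0 m => m_ge0.
  rewrite divr_gt0 ?mulr_gt0 ?ltr_wpDl//= ltr_pdivrMr ?mulr_gt0 ?ltr_wpDl//; lra.
rewrite mulrA ler_pdivrMr ?mulr_gt0 ?ltr_wpDl//.
have := normr_ge0 m; nra.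
Qed.

End logarithmic_scale.

(** * Transfer between the decay of [Q] in [ln n] and that of [G] in [t] *)

Section tail_transfer.
Context {R : realType}.
Variables (p : R) (G : R -> R) (Q : nat -> R).
Hypothesis p_gt0 : 0 < p.
Hypothesis nincr_G : {homo G : s t / s <= t >-> t <= s}.
Hypothesis Q_le : forall b A, 0 < b < 1 -> \forall n \near \oo,
  Q n <= expR (ln n%:R) * G (b / p * ln n%:R) + expR (A * ln n%:R).
Hypothesis Q_ge : forall b, 1 < b -> \forall n \near \oo,
  expR (ln n%:R) * G (b / p * ln n%:R) / 2 <= Q n.
Implicit Types (a b c e s t : R) (n : nat).

Lemma sum_exp_le a e : 0 < e -> \forall n \near \oo,
  expR (a * ln n%:R) *+ 2 <= expR ((a + e) * ln n%:R).
Proof.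
move=> e_gt0; near=> n; rewrite mulrDl expRD -[_ *+ 2]mulr_natr ler_pM2l ?expR_gt0//.
apply: le_trans (expR_ge1Dx _); rewrite -[2]/(1 + 1) lerD2l.
rewrite mulrC -ler_pdivrMr//; near: n; exact: near_ln_ge.
Unshelve. all: by end_near. Qed.

(** [Q_le] is used with [b = 1 - d], where [d] costs [e / 2] in the exponent, and with [A] equal to
    the resulting exponent, so that both terms have the same bound. The other [e / 2] absorbs the
    factor [2] of their sum. *)
Lemma near_Q_le a e : 0 < e -> (\forall t \near +oo, G t <= expR (a * t)) ->
  \forall n \near \oo, Q n <= expR ((1 + p^-1 * a + e) * ln n%:R).
Proof.
move=> e_gt0 Ga; have [d /andP[d_gt0 d_lt1] d_small] := small_slope (p^-1 * a) e_gt0.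
have b01 : 0 < 1 - d < 1 by lra.
have bp : 0 < (1 - d) / p by rewrite divr_gt0//; lra.
near=> n.
have v_ge0 : 0 <= ln (n%:R : R) by near: n; exact: near_ln_ge.
have Qn : Q n <= expR (ln n%:R) * G ((1 - d) / p * ln n%:R) +
    expR ((1 + p^-1 * a + e / 2) * ln n%:R) by near: n; exact: Q_le.
have Gn : G ((1 - d) / p * ln n%:R) <= expR (a * ((1 - d) / p * ln n%:R)).
  by near: n; exact: near_scaled_ln Ga.
have : expR ((1 + p^-1 * a + e / 2) * ln n%:R) *+ 2 <=
    expR ((1 + p^-1 * a + e / 2 + e / 2) * ln (n%:R : R)).
  by near: n; apply: sum_exp_le; rewrite divr_gt0.
rewrite -!addrA -splitr !addrA; apply: le_trans.
apply: (le_trans Qn); rewrite [expR _ *+ 2]mulr2n lerD2r.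
apply: (@le_trans _ _ (expR (ln n%:R) * expR (a * ((1 - d) / p * ln n%:R)))).
  by rewrite ler_pM2l ?expR_gt0.
rewrite -expRD ler_expR.
have -> : a * ((1 - d) / p * ln n%:R) = p^-1 * a * (1 - d) * ln n%:R by ring.
rewrite -{1}[ln n%:R]mul1r -mulrDl ler_wpM2r//.
have := ler_norm (- (p^-1 * a)); rewrite normrN => /(ler_wpM2r (ltW d_gt0)).
by move: d_small; set m := p^-1 * a => ? ?; lra.
Unshelve. all: by end_near. Qed.

Lemma near_Q_ge a e : 0 < e -> (\forall t \near +oo, expR (a * t) <= G t) ->
  \forall n \near \oo, expR ((1 + p^-1 * a - e) * ln n%:R) <= Q n.
Proof.
move=> e_gt0 Ga; have [d /andP[d_gt0 d_lt1] d_small] := small_slope (p^-1 * a) e_gt0.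
have b1 : 1 < 1 + d by lra.
have bp : 0 < (1 + d) / p by rewrite divr_gt0//; lra.
near=> n.
have v_ge0 : 0 <= ln (n%:R : R) by near: n; exact: near_ln_ge.
have Qn : expR (ln n%:R) * G ((1 + d) / p * ln n%:R) / 2 <= Q n.
  by near: n; exact: Q_ge.
have Gn : expR (a * ((1 + d) / p * ln n%:R)) <= G ((1 + d) / p * ln n%:R).
  by near: n; exact: near_scaled_ln Ga.
have : expR ((1 + p^-1 * a - e) * ln n%:R) *+ 2 <=
    expR ((1 + p^-1 * a - e + e / 2) * ln (n%:R : R)).
  by near: n; apply: sum_exp_le; rewrite divr_gt0.
rewrite -[_ *+ 2]mulr_natr -ler_pdivlMr// => /le_trans; apply; apply: le_trans Qn.
rewrite ler_pM2r ?invr_gt0//.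
apply: (@le_trans _ _ (expR (ln n%:R) * expR (a * ((1 + d) / p * ln n%:R)))).
  rewrite -expRD ler_expR.
  have -> : a * ((1 + d) / p * ln n%:R) = p^-1 * a * (1 + d) * ln n%:R by ring.
  rewrite -{2}[ln n%:R]mul1r -mulrDl ler_wpM2r//.
  have := ler_norm (- (p^-1 * a)); rewrite normrN => /(ler_wpM2r (ltW d_gt0)).
  by move: d_small; set m := p^-1 * a => ? ?; lra.
by rewrite ler_pM2l ?expR_gt0.
Unshelve. all: by end_near. Qed.

(** By monotonicity [G t] is at most its value at a grid point [w = k * ln n] just below [t], where
    [Q_ge] applies. The grid gap [K] and the factor [2] are bounded errors, below [e / 2 * t] for
    large [t]; the choice [b != 1] costs at most another [e / 2 * t]. *)
Lemma near_tail_le c e : 0 < e ->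
  (\forall n \near \oo, Q n <= expR (c * ln n%:R)) ->
  \forall t \near +oo, G t <= expR ((p * (c - 1) + e) * t).
Proof.
move=> e_gt0 Qc; set m := p * (c - 1).
have [d /andP[d_gt0 d_lt1] d_small] := small_slope m e_gt0.
have d1_gt0 : 0 < 1 - d by lra.
have b1 : 1 < (1 - d)^-1 by rewrite invf_gt1//; lra.
(* Taking [b] as an inverse makes the exponent linear in [d]: [(c - 1) * ln n = m * (1 - d) * w] for
   [w = k * ln n]. *)
pose k := (1 - d)^-1 / p; have k_gt0 : 0 < k by rewrite divr_gt0 ?invr_gt0.
have Qb : \forall n \near \oo, G (k * ln n%:R) <= expR ((c - 1) * ln n%:R + 1).
  near=> n.
  have Qn : Q n <= expR (c * ln n%:R) by near: n.
  have Qn' : expR (ln n%:R) * G (k * ln n%:R) / 2 <= Q n by near: n; exact: Q_ge.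
  rewrite mulrBl mul1r expRD expRB [leRHS]mulrAC ler_pdivlMr ?expR_gt0// mulrC.
  have := le_trans Qn' Qn; rewrite ler_pdivrMr// => /le_trans; apply.
  by rewrite ler_pM2l ?expR_gt0//; have := expR_ge1Dx (1 : R); lra.
near=> t.
have [n Gn /andP[w_ge w_le]] : exists2 n, G (k * ln n%:R) <= expR ((c - 1) * ln n%:R + 1)
    & t - k * ln 2 <= k * ln n%:R <= t.
  by near: t; have := near_exp_grid k_gt0 Qb; apply: filterS => t [].
apply: (le_trans (nincr_G w_le)); apply: (le_trans Gn); rewrite ler_expR.
have -> : (c - 1) * ln n%:R = m * (1 - d) * (k * ln n%:R).
  by rewrite /m /k; field; rewrite !gt_eqF.
move: w_ge w_le; set w := k * ln n%:R; set K := k * ln 2 => w_ge w_le.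
have K_ge0 : 0 <= K by rewrite mulr_ge0 ?(ltW k_gt0)// ln_ge0 ?ler1n.
have t_large : (`|m| * K + 1) * 2 / e + K <= t.
  by near: t; apply: nbhs_pinfty_ge; exact: num_real.
have w_ge0 : 0 <= w.
  rewrite (le_trans _ w_ge)// subr_ge0 (le_trans _ t_large)// lerDr.
  by have := mulr_ge0 (normr_ge0 m) K_ge0 => mK; rewrite divr_ge0 ?(ltW e_gt0)//; lra.
have t_large' : (`|m| * K + 1) <= e / 2 * t.
  have : (`|m| * K + 1) * 2 / e <= t by lra.
  by rewrite ler_pdivrMr//; lra.
have h1 : m * (w - t) <= `|m| * K.
  rewrite (le_trans (ler_norm _))// normrM ler_wpM2l// ler0_norm; lra.
have md : - m * d <= e / 2.
  by rewrite (le_trans _ d_small)// ler_wpM2r ?(ltW d_gt0)// (le_trans (ler_norm _))// normrN.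
have h2 : - (m * d * w) <= e / 2 * w by rewrite -mulNr ler_wpM2r// -mulNr.
have h3 : e / 2 * w <= e / 2 * t by rewrite ler_wpM2l// divr_ge0// ltW.
lra.
Unshelve. all: by end_near. Qed.

Lemma near_tail_ge c e : 0 < e ->
  (\forall n \near \oo, expR (c * ln n%:R) <= Q n) ->
  \forall t \near +oo, expR ((p * (c - 1) - e) * t) <= G t.
Proof.
move=> e_gt0 Qc; set m := p * (c - 1).
have [d /andP[d_gt0 d_lt1] d_small] := small_slope m e_gt0.
have d1_gt0 : 0 < 1 + d by lra.
have b1 : 0 < (1 + d)^-1 < 1 by rewrite invr_gt0 invf_lt1 d1_gt0//=; lra.
pose k := (1 + d)^-1 / p; have k_gt0 : 0 < k by rewrite divr_gt0 ?invr_gt0.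
have Qb : \forall n \near \oo, expR ((c - 1) * ln n%:R - 1) <= G (k * ln n%:R).
  near=> n.
  have Qn : expR (c * ln n%:R) <= Q n by near: n.
  (* With [A = c - 1] the error is at most [expR (c * ln n - 1)] once [ln n >= 1], that is, less
     than half of the assumed lower bound on [Q n]. *)
  have Qn' : Q n <= expR (ln n%:R) * G (k * ln n%:R) + expR ((c - 1) * ln n%:R).
    by near: n; exact: Q_le.
  have n_ge1 : 1 <= ln (n%:R : R) by near: n; exact: near_ln_ge.
  rewrite -(@ler_pM2l _ (expR (ln n%:R))) ?expR_gt0//.
  rewrite -(lerD2r (expR ((c - 1) * ln n%:R))); apply: (le_trans _ Qn').
  apply: (le_trans _ Qn); rewrite -expRD.
  have -> : ln (n%:R : R) + ((c - 1) * ln n%:R - 1) = c * ln n%:R - 1 by ring.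
  apply: (@le_trans _ _ (expR (c * ln n%:R - 1) *+ 2)).
    by rewrite [expR _ *+ 2]mulr2n lerD2l ler_expR; lra.
  rewrite expRD -[_ *+ 2]mulr_natr -mulrA -[leRHS]mulr1 ler_pM2l ?expR_gt0//.
  by rewrite expRN mulrC ler_pdivrMr ?expR_gt0// mul1r; have := expR_ge1Dx (1 : R); lra.
near=> t.
have [n Gn /andP[w_ge w_le]] : exists2 n, expR ((c - 1) * ln n%:R - 1) <= G (k * ln n%:R)
    & t <= k * ln n%:R <= t + k * ln 2.
  by near: t; have := near_exp_grid k_gt0 Qb; apply: filterS => t [].
apply: (le_trans _ (nincr_G w_ge)); apply: (le_trans _ Gn); rewrite ler_expR.
have -> : (c - 1) * ln n%:R = m * (1 + d) * (k * ln n%:R).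
  by rewrite /m /k; field; rewrite !gt_eqF.
move: w_ge w_le; set w := k * ln n%:R; set K := k * ln 2 => w_ge w_le.
have K_ge0 : 0 <= K by rewrite mulr_ge0 ?(ltW k_gt0)// ln_ge0 ?ler1n.
have t_large : (`|m| * K + e / 2 * K + 1) * 2 / e <= t.
  by near: t; apply: nbhs_pinfty_ge; exact: num_real.
have t_ge0 : 0 <= t.
  rewrite (le_trans _ t_large)//.
  have := mulr_ge0 (normr_ge0 m) K_ge0 => mK; have := mulr_ge0 (ltW e_gt0) K_ge0 => eK.
  by rewrite divr_ge0 ?(ltW e_gt0)//; lra.
have t_large' : (`|m| * K + e / 2 * K + 1) <= e / 2 * t.
  by move: t_large; rewrite ler_pdivrMr//; lra.
have h1 : - (m * (w - t)) <= `|m| * K.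
  rewrite (le_trans (ler_norm _))// normrN normrM ler_wpM2l// ger0_norm; lra.
have md : - m * d <= e / 2.
  by rewrite (le_trans _ d_small)// ler_wpM2r ?(ltW d_gt0)// (le_trans (ler_norm _))// normrN.
have h2 : - (m * d * w) <= e / 2 * w.
  rewrite -mulNr; apply: ler_wpM2r; first exact: le_trans w_ge.
  by rewrite -mulNr.
have h3 : e / 2 * w <= e / 2 * t + e / 2 * K.
  by rewrite -mulrDr ler_wpM2l// divr_ge0// ltW.
lra.
Unshelve. all: by end_near. Qed.

Local Open Scope ereal_scope.

Let L n := ((ln (n%:R : R))^-1)%:E * lne (Q n)%:E.
Let g (t : R) := (t^-1)%:E * lne (G t)%:E.

Lemma near_rate_le c : (\forall n \near \oo, L n <= c%:E) <->
  (\forall n \near \oo, (Q n <= expR (c * ln n%:R))%R).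
Proof.
have v_gt0 : \forall n \near \oo, (0 < ln (n%:R : R))%R.
  by apply: filterS (near_ln_ge 1) => n; exact: lt_le_trans.
by split; apply: filterS2 v_gt0 => n v_gt0; rewrite /L rate_le.
Qed.

Lemma near_rate_ge c : (\forall n \near \oo, c%:E <= L n) <->
  (\forall n \near \oo, (expR (c * ln n%:R) <= Q n)%R).
Proof.
have v_gt0 : \forall n \near \oo, (0 < ln (n%:R : R))%R.
  by apply: filterS (near_ln_ge 1) => n; exact: lt_le_trans.
by split; apply: filterS2 v_gt0 => n v_gt0; rewrite /L rate_ge.
Qed.

Lemma near_tail_rate_le c : (\forall t \near +oo%R, g t <= c%:E) <->
  (\forall t \near +oo%R, (G t <= expR (c * t))%R).
Proof.
have v_gt0 : \forall t \near +oo%R, (0 < t :> R)%R by apply: nbhs_pinfty_gt; exact: num_real.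
by split; apply: filterS2 v_gt0 => t v_gt0; rewrite /g rate_le.
Qed.

Lemma near_tail_rate_ge c : (\forall t \near +oo%R, c%:E <= g t) <->
  (\forall t \near +oo%R, (expR (c * t) <= G t)%R).
Proof.
have v_gt0 : \forall t \near +oo%R, (0 < t :> R)%R by apply: nbhs_pinfty_gt; exact: num_real.
by split; apply: filterS2 v_gt0 => t v_gt0; rewrite /g rate_ge.
Qed.

(** [near_tail_le] bounds the exponent of [G] through that of [Q]; this solves the bound for the
    exponent of [Q], infinite values included. *)
Lemma rate_affineK x y : x <= (- p)%:E + p%:E * y -> 1 + (p^-1)%:E * x <= y.
Proof.
case: y => [y| |]; last 2 first.
- by rewrite leey.
- rewrite mulrNy gtr0_sg// mul1e addeNy [X in is_true X -> _]leeNy_eq => /eqP ->.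
  by rewrite mulrNy gtr0_sg ?invr_gt0// mul1e addeNy.
rewrite -EFinM -EFinD; case: x => [x| |]//; last first.
  by move=> _; rewrite mulrNy gtr0_sg ?invr_gt0// mul1e addeNy leNye.
rewrite -EFinM -EFinD !lee_fin => h.
by rewrite -lerBrDl ler_pdivrMl// mulrBr mulr1; lra.
Qed.

Lemma rate_affineKV x y : (- p)%:E + p%:E * y <= x -> y <= 1 + (p^-1)%:E * x.
Proof.
case: y => [y| |]; last 2 first.
- rewrite mulry gtr0_sg// mul1e addey// [X in is_true X -> _]leye_eq => /eqP ->.
  by rewrite mulry gtr0_sg ?invr_gt0// mul1e addey.
- by rewrite leNye.
rewrite -EFinM -EFinD; case: x => [x| |]//; last first.
  by move=> _; rewrite mulry gtr0_sg ?invr_gt0// mul1e addey// leey.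
rewrite -EFinM -EFinD !lee_fin => h.
by rewrite -lerBlDl ler_pdivlMl// mulrBr mulr1; lra.
Qed.

Lemma limn_esup_rate : limn_esup L = 1 + (p^-1)%:E * limf_esup g (pinfty_nbhs R).
Proof.
apply/eqP; rewrite eq_le; apply/andP; split.
- apply: lee_affine_of_gt; rewrite ?invr_gt0// => c e gc e_gt0.
  apply: limf_esup_le_near; apply/near_rate_le/near_Q_le => //.
  apply/near_tail_rate_le.
  by apply: filterS (limf_esup_lt_near _ gc) => t /ltW.
- apply/rate_affineK/lee_affine_of_gt => // c e Lc e_gt0.
  apply: limf_esup_le_near; apply/near_tail_rate_le.
  have -> : (- p + p * c = p * (c - 1))%R by ring.
  apply/near_tail_le => //; apply/near_rate_le.
  by apply: filterS (limf_esup_lt_near _ Lc) => n /ltW.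
Qed.

Lemma limn_einf_rate : limn_einf L = 1 + (p^-1)%:E * limf_einf g (pinfty_nbhs R).
Proof.
apply/eqP; rewrite eq_le; apply/andP; split.
- apply/rate_affineKV/gee_affine_of_lt => // c e Lc e_gt0.
  apply: limf_einf_ge_near; apply/near_tail_rate_ge.
  have -> : (- p + p * c = p * (c - 1))%R by ring.
  apply/near_tail_ge => //; apply/near_rate_ge.
  by apply: filterS (limf_einf_gt_near _ Lc) => n /ltW.
- apply: gee_affine_of_lt; rewrite ?invr_gt0// => c e gc e_gt0.
  apply: limf_einf_ge_near; apply/near_rate_ge/near_Q_ge => //.
  apply/near_tail_rate_ge.
  by apply: filterS (limf_einf_gt_near _ gc) => t /ltW.
Qed.

End tail_transfer.

(** * Independence: from events to nonnegative functions *)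

Section independence.
Context {d : measure_display} {T : measurableType d} {R : realType}.
Variable P : probability T R.
Implicit Types (X : {RV P >-> R}) (f : R -> R).
Local Open Scope ereal_scope.

Lemma prob_integral (b : T -> bool) : measurable_fun setT b ->
  P [set w | b w] = \int[P]_w ((b w)%:R)%:E.
Proof.
move=> mb; have mA : measurable [set w | b w].
  by rewrite -[X in measurable X]setTI; exact: (mb measurableT [set true]).
rewrite -{1}[X in P X]setIT -integral_indic//; apply: eq_integral => w _.
rewrite indicE (_ : (w \in _) = b w)//; apply/idP/idP; rewrite inE//.
Qed.

Import HBNNSimple.

(** The last hypothesis is independence of [X] and [h] tested on indicators. Simple functions
    increasing to [f] and monotone convergence carry it over to [f]; finiteness of the integral of
    [h] lets the product on the right pass to the limit. *)
Lemma integral_indep_approx X f (h : T -> R) :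
  measurable_fun setT f -> (forall x, 0 <= f x)%R ->
  measurable_fun setT h -> (forall w, 0 <= h w)%R ->
  \int[P]_w (h w)%:E \is a fin_num ->
  (forall B, measurable B ->
    \int[P]_w (\1_B (X w) * h w)%:E = P (X @^-1` B) * \int[P]_w (h w)%:E) ->
  \int[P]_w (f (X w) * h w)%:E =
    \int[P]_w (f (X w))%:E * \int[P]_w (h w)%:E.
Proof.
move=> mf f0 mh h0 h_fin indepB.
have /measurable_EFinP mEf := mf.
have Ef0 x : setT x -> 0 <= (EFin \o f) x by rewrite lee_fin.
pose g := nnsfun_approx measurableT mEf.
have mgX n : measurable_fun setT (g n \o X) by exact: measurableT_comp.
have g_nd x : {homo (fun n => g n x) : m n / (m <= n)%N >-> (m <= n)%R}.
  by move=> m n mn; exact/lefP/nd_nnsfun_approx.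
have gf x : (g n x)%:E @[n --> \oo] --> (f x)%:E.
  exact: (@cvg_nnsfun_approx _ _ _ _ measurableT _ mEf Ef0 x).
have lhs : \int[P]_w (g n (X w) * h w)%:E @[n --> \oo] -->
    \int[P]_w (f (X w) * h w)%:E.
  have -> : \int[P]_w (f (X w) * h w)%:E =
      \int[P]_w limn (fun n => (g n (X w) * h w)%:E).
    apply: eq_integral => w _; apply/esym/cvg_lim => //.
    under eq_fun do rewrite EFinM muleC.
    by rewrite EFinM muleC; apply: cvgeZl.
  apply: cvg_monotone_convergence => //.
  - by move=> n; apply/measurable_EFinP/measurable_funM => //; exact: mgX.
  - by move=> n w _; rewrite lee_fin mulr_ge0.
  - by move=> w _ m n mn; rewrite lee_fin ler_wpM2r// g_nd.
have rhs : \int[P]_w (g n (X w))%:E * \int[P]_w (h w)%:E @[n --> \oo] -->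
    \int[P]_w (f (X w))%:E * \int[P]_w (h w)%:E.
  apply: cvgeZr => //.
  have -> : \int[P]_w (f (X w))%:E = \int[P]_w limn (fun n => (g n (X w))%:E).
    by apply: eq_integral => w _; apply/esym/cvg_lim.
  apply: cvg_monotone_convergence => //.
  - by move=> n; apply/measurable_EFinP; exact: mgX.
  - by move=> n w _; rewrite lee_fin.
  - by move=> w _ m n mn; rewrite lee_fin g_nd.
suff E n : \int[P]_w (g n (X w) * h w)%:E =
    \int[P]_w (g n (X w))%:E * \int[P]_w (h w)%:E.
  by rewrite -(cvg_lim _ lhs)// -(cvg_lim _ rhs)//; apply: congr_lim; exact/funext.
pose r := finmap.enum_fset (fset_set (range (g n))).
have gE x : g n x = (\sum_(y <- r) y * \1_(g n @^-1` [set y]) x)%R.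
  by rewrite [LHS]fimfunE fsbig_finite.
have mind y : measurable (g n @^-1` [set y]) by [].
have ind_ge0 y x : (0 <= y * \1_(g n @^-1` [set y]) x)%R.
  rewrite indicE; case: (boolP (x \in _)); last by rewrite mulr0.
  by rewrite mulr1 inE /= => <-.
have mindX y : measurable_fun setT (fun w => \1_(g n @^-1` [set y]) (X w) : R)%R.
  exact: (measurableT_comp (measurable_indic (mind y)) (measurable_funPT X)).
have step (k : T -> R) : measurable_fun setT k -> (forall w, 0 <= k w)%R ->
    \int[P]_w (g n (X w) * k w)%:E =
    \sum_(y <- r) \int[P]_w (y * \1_(g n @^-1` [set y]) (X w) * k w)%:E.
  move=> mk k0; rewrite -ge0_integral_sum//.
  - by apply: eq_integral => w _; rewrite gE mulr_suml sumEFin.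
  - by move=> y; apply/measurable_EFinP; do 2 ?apply: measurable_funM.
  - by move=> y w _; rewrite lee_fin mulr_ge0.
rewrite step//.
under [X in X * _]eq_integral do rewrite -[g n _]mulr1.
rewrite (step (fun=> 1%R))// ge0_sume_distrl; last first.
  by move=> y _; apply: integral_ge0 => w _; rewrite lee_fin mulr1.
(* A negative [y] is not a value of the nonnegative [g n]: its level set is empty and both sides
   vanish. *)
apply: eq_bigr => y _; have [y0|y0] := leP 0%R y; last first.
  have z w : (y * \1_(g n @^-1` [set y]) (X w) = 0)%R.
    rewrite indicE; case: (boolP (X w \in _)); last by rewrite mulr0.
    by rewrite inE /= => gy; move: y0; rewrite -gy ltNge fun_ge0.
  under eq_integral do rewrite z mul0r.
  by under [X in _ = X * _]eq_integral do rewrite z mul0r; rewrite !integral0 mul0e.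
under eq_integral do rewrite -mulrA EFinM.
rewrite ge0_integralZl//; first last.
- by move=> w _; rewrite lee_fin mulr_ge0.
- by apply/measurable_EFinP/measurable_funM.
rewrite indepB// muleA; congr (_ * _).
under [RHS]eq_integral do rewrite mulr1 EFinM.
rewrite ge0_integralZl//; last exact/measurable_EFinP.
congr (_ * _); rewrite -(setIT (X @^-1` _)) -integral_indic//.
by rewrite -[X @^-1` _]setTI; exact: (measurable_funPT X).
Qed.

Section product_formula.
Variables (Y : nat -> {RV P >-> R}) (indepY : mutually_independent Y).
Variable f : nat -> R -> R.
Hypothesis mf : forall i, measurable_fun setT (f i).
Hypothesis f_ge0 : forall i x, (0 <= f i x)%R.
Hypothesis f_fin : forall i, \int[P]_w (f i (Y i w))%:E \is a fin_num.

Let measurable_preY i B : measurable B -> measurable (Y i @^-1` B).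
Proof. by move=> mB; rewrite -[_ @^-1` _]setTI; exact: (measurable_funPT (Y i)). Qed.

Let measurable_factors (s1 s2 : seq nat) (B : nat -> set R) :
  (forall i, measurable (B i)) ->
  measurable_fun setT (fun w =>
    (\prod_(i <- s1) f i (Y i w) * \prod_(i <- s2) \1_(B i) (Y i w))%R).
Proof.
move=> mB; apply: measurable_funM; apply: measurable_prod => i _.
  exact: (measurableT_comp (mf i) (measurable_funPT (Y i))).
exact: (measurableT_comp (measurable_indic (mB i)) (measurable_funPT (Y i))).
Qed.

Let factors_ge0 (s1 s2 : seq nat) (B : nat -> set R) w :
  (0 <= \prod_(i <- s1) f i (Y i w) * \prod_(i <- s2) \1_(B i) (Y i w))%R.
Proof. by rewrite mulr_ge0// prodr_ge0. Qed.

(* Independence is only assumed for events; it is extended to functions one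
   factor at a time, the remaining factors being still indicators. *)
Lemma integral_prod_indic_indep (s1 s2 : seq nat) (B : nat -> set R) :
  uniq (s1 ++ s2) -> (forall i, measurable (B i)) ->
  \int[P]_w (\prod_(i <- s1) f i (Y i w) * \prod_(i <- s2) \1_(B i) (Y i w))%:E =
  \prod_(i <- s1) \int[P]_w (f i (Y i w))%:E * \prod_(i <- s2) P (Y i @^-1` B i).
Proof.
elim: s1 s2 B => [|j s1 IH] s2 B us mB.
  under eq_integral do rewrite big_nil mul1r.
  rewrite big_nil mul1e -indepY//.
  have mBs : measurable (\big[setI/setT]_(i <- s2) (Y i @^-1` B i)).
    by apply: big_ind => // [|i _]; [exact: measurableI|exact: measurable_preY].
  rewrite -[X in P X]setIT -integral_indic//; apply: eq_integral => w _; congr EFin.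
  elim: s2 {us mBs} => [|i s2 IH]; first by rewrite !big_nil indicT.
  by rewrite !big_cons IH indicI.
have [js us1 us2] : [/\ j \notin s1, j \notin s2 & uniq (s1 ++ j :: s2)].
  move: us => /= /andP[]; rewrite mem_cat negb_or => /andP[js1 js2] us.
  by split=> //; rewrite -(cat1s j) uniq_catCA /= mem_cat negb_or js1 js2.
have us' : uniq (s1 ++ s2) by move: us => /= /andP[].
rewrite big_cons -muleA -IH//.
under eq_integral do rewrite big_cons -mulrA.
apply: (@integral_indep_approx (Y j) (f j)
  (fun w => \prod_(i <- s1) f i (Y i w) * \prod_(i <- s2) \1_(B i) (Y i w))%R) => //.
- exact: measurable_factors.
- rewrite IH// fin_numM//; first by rewrite prode_fin_num.
  by rewrite prode_fin_num// => i _; rewrite fin_num_measure//; exact: measurable_preY.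
(* The indicator of [B'] at [Y j] is absorbed into the second product, so that the induction
   hypothesis applies to [j :: s2]; as [j] is not in [s2], the other factors keep their sets. *)
move=> B' mB'; pose C i := if i == j then B' else B i.
have mC i : measurable (C i) by rewrite /C; case: ifP.
have Cs2 i : i \in s2 -> C i = B i.
  by rewrite /C; case: eqP => // -> ; rewrite (negbTE us1).
have := IH (j :: s2) C us2 mC.
under eq_integral => w _.
  rewrite big_cons {1}/C eqxx mulrCA.
  under [X in (_ * (_ * X))%R]eq_big_seq => i /Cs2 -> do over.
  over.
move=> ->; rewrite big_cons {1}/C eqxx IH// muleCA; congr (_ * (_ * _)).
by apply: eq_big_seq => i /Cs2 ->.
Qed.

Lemma integral_prod_indep (s : seq nat) : uniq s ->
  \int[P]_w (\prod_(i <- s) f i (Y i w))%:E =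
  \prod_(i <- s) \int[P]_w (f i (Y i w))%:E.
Proof.
move=> us; have := @integral_prod_indic_indep s [::] (fun=> setT).
rewrite cats0 big_nil mule1 => <- //.
by apply: eq_integral => w _; rewrite big_nil mulr1.
Qed.

End product_formula.

Lemma eq_integral_id (Y : nat -> {RV P >-> R}) (g : R -> R) i :
  identically_distributed Y -> measurable_fun setT g -> (forall x, 0 <= g x)%R ->
  \int[P]_w (g (Y i w))%:E = \int[P]_w (g (Y 0%N w))%:E.
Proof.
move=> idY /measurable_EFinP mg g0.
have g0' x : 0 <= (EFin \o g) x by rewrite lee_fin.
rewrite -(ge0_integral_distribution (Y i) mg g0').
rewrite -(ge0_integral_distribution (Y 0%N) mg g0').
by apply: eq_measure_integral => A mA _; exact: idY.
Qed.

End independence.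

(** * Pointwise inequalities behind the two probability bounds *)

Section pointwise_bounds.
Context {R : realType} {I : eqType}.
Implicit Types (s : seq I) (x : I -> R).

(** Either some [x i] exceeds [b] and the first sum is at least [1], or no truncation takes place
    and the second term is [expR (l * (sum - a))], at least [1] when the sum exceeds [a]. *)
Lemma truncated_sum_le s x (a b l : R) : 0 <= l ->
  (a < \sum_(i <- s) x i)%R%:R <= \sum_(i <- s) (b < x i)%R%:R +
    expR (- (l * a)) * \prod_(i <- s) (expR (l * x i) * (x i <= b)%R%:R) :> R.
Proof.
move=> l_ge0.
have sum_ge0 : 0 <= \sum_(i <- s) (b < x i)%R%:R :> R by rewrite sumr_ge0.
have prod_ge0 : 0 <= expR (- (l * a)) *
    \prod_(i <- s) (expR (l * x i) * (x i <= b)%R%:R) :> R.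
  by rewrite mulr_ge0 ?expR_ge0// prodr_ge0// => i _; rewrite mulr_ge0 ?expR_ge0.
have [as_lt|] := ltP a (\sum_(i <- s) x i); last by rewrite addr_ge0.
have [/hasP[i si bi]|/hasPn sb] := boolP (has (fun i => b < x i) s).
  rewrite -[leLHS]addr0 lerD// (big_rem i)//= bi lerDl sumr_ge0//.
rewrite -[leLHS]add0r lerD//.
rewrite (eq_big_seq (fun i => expR (l * x i))); last first.
  by move=> i /sb; rewrite -leNgt => ->; rewrite mulr1.
rewrite -expR_sum -mulr_sumr -expRD -expR0 ler_expR addrC -mulrBr mulr_ge0//.
by rewrite subr_ge0 ltW.
Qed.

(* A summand of index [j] on the left is compensated on the right unless [j] is
   the only index with [t < x j] and the other terms sum to more than [y]. *)
Lemma single_jump_le s x (t y l : R) : uniq s -> 0 <= l ->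
  \sum_(j <- s) (t < x j)%R%:R <= (y + t < \sum_(i <- s) x i)%R%:R +
    \sum_(j <- s) \sum_(i <- rem j s) (t < x j)%R%:R * (t < x i)%R%:R +
    \sum_(j <- s) expR (l * y) *
      ((t < x j)%R%:R * \prod_(i <- rem j s) expR (- (l * x i))) :> R.
Proof.
move=> us l_ge0.
pose D j : R := \sum_(i <- rem j s) (t < x i)%R%:R.
pose E j := expR (l * y) * \prod_(i <- rem j s) expR (- (l * x i)).
have E_ge0 j : 0 <= E j.
  by rewrite mulr_ge0 ?expR_ge0// prodr_ge0// => i _; exact: expR_ge0.
rewrite -addrA -big_split/= -lerBlDr -sumrB.
rewrite (eq_bigr (fun j => (t < x j)%R%:R * (1 - D j - E j))); last first.
  by move=> j _; rewrite -mulr_sumr -/(D j) mulrCA -/(E j); ring.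
have [/hasP[j sj tj]|/hasPn st] := boolP (has (fun j => t < x j) s); last first.
  rewrite big1_seq// => j /andP[_ /st] /negbTE ->; by rewrite mul0r.
have D_ge0 i : 0 <= D i by rewrite sumr_ge0.
rewrite (big_rem j)//= tj mul1r.
have rest_le0 : \sum_(i <- rem j s) (t < x i)%R%:R * (1 - D i - E i) <= 0.
  rewrite big_seq sumr_le0// => i; rewrite mem_rem_uniq// inE => /andP[ij si].
  case: ltP => //; rewrite ?mul0r// => ti; rewrite mul1r.
  have : 1 <= D i.
    have jr : j \in rem i s by rewrite mem_rem_uniq// inE eq_sym ij.
    by rewrite /D (big_rem j)//= tj lerDl sumr_ge0.
  by have := E_ge0 i; lra.
have jE : 1 - E j <= (y + t < \sum_(i <- s) x i)%R%:R.
  case: ltP => [_|]; first by rewrite lerBlDr lerDl.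
  rewrite (big_rem j)//= => sum_le; rewrite -[false%:R]/(0 : R).
  rewrite lerBlDr add0r /E -expR_sum -expRD -expR0 ler_expR sumrN -mulr_sumr.
  by rewrite -mulrBr mulr_ge0// subr_ge0; lra.
by have := D_ge0 j; lra.
Qed.

End pointwise_bounds.

(** * Upper and lower bounds for the law of a sum *)

Section probability_bounds.
Context {d : measure_display} {T : measurableType d} {R : realType}.
Variables (P : probability T R) (Y : nat -> {RV P >-> R}).
Hypothesis iidY : iid Y.
Local Open Scope ereal_scope.

Let indepY : mutually_independent Y := iidY.1.
Let idY : identically_distributed Y := iidY.2.
Let q (t : R) := P [set w | (t < Y 0%N w)%R].

Lemma measurable_gt_RV (t : R) i : measurable_fun setT (fun w => t < Y i w)%R.
Proof. by apply: measurable_fun_ltr => //; exact: measurable_cst. Qed.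

Lemma measurable_gt_sum (a : R) (s : seq nat) :
  measurable_fun setT (fun w => a < \sum_(i <- s) Y i w)%R.
Proof. by apply: measurable_fun_ltr => //; exact: measurable_sum. Qed.

Lemma measurable_bool_natr (b : T -> bool) :
  measurable_fun setT b -> measurable_fun setT (fun w => (b w)%:R : R)%R.
Proof.
move=> mb; rewrite (_ : (fun w => _) = \1_[set w | b w] :> (T -> R))%R.
  apply: measurable_indic.
  by rewrite -[X in measurable X]setTI; exact: (mb measurableT [set true]).
apply/funext => w; rewrite indicE (_ : (w \in _) = b w)//.
by apply/idP/idP; rewrite inE.
Qed.

Lemma measurable_gt_natr (t : R) :
  measurable_fun setT (fun x : R => (t < x)%R%:R : R)%R.
Proof.
rewrite (_ : (fun x => _) = \1_`]t, +oo[ :> (R -> R))%R.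
  exact: measurable_indic.
apply/funext => x; rewrite indicE (_ : (x \in _) = (t < x)%R)//.
by apply/idP/idP; rewrite inE/= in_itv/= andbT.
Qed.

Lemma measurable_le_natr (t : R) :
  measurable_fun setT (fun x : R => (x <= t)%R%:R : R)%R.
Proof.
rewrite (_ : (fun x => _) = \1_`]-oo, t] :> (R -> R))%R.
  exact: measurable_indic.
apply/funext => x; rewrite indicE (_ : (x \in _) = (x <= t)%R)//.
by apply/idP/idP; rewrite inE/= in_itv/=.
Qed.

Lemma integral_tail (t : R) i : \int[P]_w ((t < Y i w)%R%:R)%:E = q t.
Proof.
rewrite (@eq_integral_id _ _ _ P Y (fun x => (t < x)%R%:R)%R)//.
  by rewrite /q prob_integral//; exact: measurable_gt_RV.
exact: measurable_gt_natr.
Qed.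

Lemma q_fin (t : R) : q t \is a fin_num.
Proof.
rewrite fin_num_measure// -[X in measurable X]setTI.
have mb := @measurable_gt_RV t 0%N; exact: (mb measurableT [set true]).
Qed.

Lemma sum_const_ereal (s : seq nat) (c : \bar R) :
  \sum_(j <- s) c = (size s)%:R%:E * c.
Proof.
by rewrite mule_natl; elim: s => [|j s IH]; rewrite ?big_nil// big_cons IH -muleS.
Qed.

Lemma prod_const_le (s : seq nat) (F : nat -> \bar R) (M : \bar R) (z : R) :
  (forall i, F i = M) -> 0 <= M -> M <= (expR z)%:E ->
  \prod_(i <- s) F i <= (expR (z * (size s)%:R))%:E.
Proof.
move=> FM M0 Mz; elim: s => [|i s IH]; first by rewrite big_nil mulr0 expR0.
rewrite big_cons FM /= -natr1 mulrDr mulr1 expRD mulrC EFinM lee_pmul//.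
by rewrite prode_ge0// => j _; rewrite FM.
Qed.

(** The expectation of [truncated_sum_le]: independence turns the product into a power, and [z]
    bounds the logarithm of the truncated exponential moment. Later [s] is [1, ..., n], whereas tail
    and moment are those of [Y 0]; identical distribution bridges the two. *)
Lemma prob_sum_le (s : seq nat) (a b l z : R) : uniq s -> (0 <= l)%R ->
  \int[P]_w (expR (l * Y 0%N w) * (Y 0%N w <= b)%R%:R)%:E <= (expR z)%:E ->
  P [set w | (a < \sum_(i <- s) Y i w)%R] <=
    (size s)%:R%:E * q b + (expR (- (l * a) + z * (size s)%:R))%:E.
Proof.
move=> us l0 Mz.
pose f (x : R) := (expR (l * x) * (x <= b)%R%:R)%R.
have f0 x : (0 <= f x)%R by rewrite mulr_ge0 ?expR_ge0.
have mf : measurable_fun setT f.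
  apply: measurable_funM; last exact: measurable_le_natr.
  by apply: measurableT_comp => //; exact: measurable_funM.
have M0 i : 0 <= \int[P]_w (f (Y i w))%:E.
  by apply: integral_ge0 => w _; rewrite lee_fin.
have Mi i : \int[P]_w (f (Y i w))%:E = \int[P]_w (f (Y 0%N w))%:E.
  exact: eq_integral_id.
have Mfin i : \int[P]_w (f (Y i w))%:E \is a fin_num.
  by rewrite Mi ge0_fin_numE// (le_lt_trans Mz)// ltry.
have mfY i : measurable_fun setT (fun w => f (Y i w)).
  exact: (measurableT_comp mf (measurable_funPT (Y i))).
have mprod : measurable_fun setT (fun w => \prod_(i <- s) f (Y i w))%R.
  by apply: measurable_prod => i _; exact: mfY.
have mtail i : measurable_fun setT (fun w => (b < Y i w)%R%:R : R)%R.
  by apply: measurable_bool_natr; exact: measurable_gt_RV.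
rewrite prob_integral; last exact: measurable_gt_sum.
apply: (@le_trans _ _ (\int[P]_w (\sum_(i <- s) (b < Y i w)%R%:R +
    expR (- (l * a)) * \prod_(i <- s) f (Y i w))%R%:E)).
  apply: ge0_le_integral => //.
  - by apply/measurable_EFinP/measurable_bool_natr; exact: measurable_gt_sum.
  - apply/measurable_EFinP/measurable_funD; last exact: measurable_funM.
    exact: measurable_sum.
  - by move=> w _; rewrite lee_fin; exact: truncated_sum_le.
under eq_integral do rewrite EFinD EFinM.
have prod0 w : 0 <= (\prod_(i <- s) f (Y i w))%:E by rewrite lee_fin prodr_ge0.
rewrite ge0_integralD//=; first last.
- exact/measurable_EFinP/measurable_funM.
- by move=> w _; rewrite mule_ge0// lee_fin expR_ge0.
- exact/measurable_EFinP/measurable_sum.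
- by move=> w _; rewrite lee_fin sumr_ge0.
rewrite ge0_integralZl//=; last exact/measurable_EFinP.
rewrite (@integral_prod_indep _ _ _ P Y indepY (fun=> f))//.
apply: leeD; last first.
  rewrite expRD EFinM lee_pmul2l ?lte_fin ?expR_gt0//.
  exact: prod_const_le Mi (M0 0%N) Mz.
under eq_integral do rewrite -sumEFin.
rewrite ge0_integral_sum//; last by move=> i; exact/measurable_EFinP.
under eq_bigr do rewrite integral_tail.
by rewrite sum_const_ereal.
Qed.

(** The expectation of [single_jump_le]. The quadratic term counts pairs of jumps; the last one is a
    Chernoff bound for the lower tail of the summands other than the jump, hence the predecessor of
    [size s]. *)
Lemma prob_sum_ge (s : seq nat) (t y l z : R) : uniq s -> (0 <= l)%R ->
  \int[P]_w (expR (- (l * Y 0%N w)))%:E <= (expR z)%:E ->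
  (size s)%:R%:E * q t <= P [set w | (y + t < \sum_(i <- s) Y i w)%R] +
    (size s)%:R%:E * ((size s)%:R%:E * (q t * q t)) +
    (size s)%:R%:E * ((expR (l * y + z * (size s).-1%:R))%:E * q t).
Proof.
move=> us l0 Mz.
pose f (x : R) := expR (- (l * x)).
pose g (x : R) : R := (t < x)%R%:R.
have g0 x : (0 <= g x)%R by rewrite /g.
have f0 x : (0 <= f x)%R by exact: expR_ge0.
have mg : measurable_fun setT g by exact: measurable_gt_natr.
have mf : measurable_fun setT f.
  apply: measurableT_comp => //.
  by apply: measurableT_comp => //; exact: measurable_funM.
have M0 i : 0 <= \int[P]_w (f (Y i w))%:E.
  by apply: integral_ge0 => w _; rewrite lee_fin.
have Mi i : \int[P]_w (f (Y i w))%:E = \int[P]_w (f (Y 0%N w))%:E.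
  exact: eq_integral_id.
have mfY i : measurable_fun setT (fun w => f (Y i w)).
  exact: (measurableT_comp mf (measurable_funPT (Y i))).
have mgY i : measurable_fun setT (fun w => g (Y i w)).
  exact: (measurableT_comp mg (measurable_funPT (Y i))).
have mprod r : measurable_fun setT (fun w => \prod_(i <- r) f (Y i w))%R.
  by apply: measurable_prod => i _; exact: mfY.
have mterm j : measurable_fun setT (fun w =>
    expR (l * y) * (g (Y j w) * \prod_(i <- rem j s) f (Y i w)))%R.
  by do 2 apply: measurable_funM => //.
have mpair j i : measurable_fun setT (fun w => g (Y j w) * g (Y i w))%R.
  exact: measurable_funM.
have term_ge0 j w : (0 <= expR (l * y) * (g (Y j w) * \prod_(i <- rem j s) f (Y i w)))%R.
  by rewrite mulr_ge0 ?expR_ge0// mulr_ge0// prodr_ge0.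
have pair_ge0 j i w : (0 <= g (Y j w) * g (Y i w))%R by rewrite mulr_ge0.
have fin_q : q t \is a fin_num by exact: q_fin.
have Mfin i : \int[P]_w (f (Y i w))%:E \is a fin_num.
  by rewrite Mi ge0_fin_numE// (le_lt_trans Mz)// ltry.
have qfin i : \int[P]_w (g (Y i w))%:E \is a fin_num by rewrite integral_tail.
have lhs : \int[P]_w (\sum_(j <- s) g (Y j w))%:E = (size s)%:R%:E * q t.
  under eq_integral do rewrite -sumEFin.
  rewrite ge0_integral_sum//; [|by move=> i; exact/measurable_EFinP|by move=> *; rewrite lee_fin].
  by under eq_bigr do rewrite integral_tail; rewrite sum_const_ereal.
have pairs : \int[P]_w (\sum_(j <- s) \sum_(i <- rem j s) (g (Y j w) * g (Y i w)))%:E <=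
    (size s)%:R%:E * ((size s)%:R%:E * (q t * q t)).
  under eq_integral do rewrite -sumEFin.
  rewrite ge0_integral_sum//; first last.
  - by move=> j w _; rewrite lee_fin sumr_ge0.
  - by move=> j; apply/measurable_EFinP/measurable_sum.
  rewrite -sum_const_ereal big_seq [leRHS]big_seq; apply: lee_sum => j sj.
  under eq_integral do rewrite -sumEFin.
  rewrite ge0_integral_sum//; first last.
  - by move=> i w _; rewrite lee_fin.
  - by move=> i; apply/measurable_EFinP.
  rewrite big_seq (eq_bigr (fun=> q t * q t)); last first.
    move=> i; rewrite mem_rem_uniq// inE => /andP[ij si].
    have := @integral_prod_indep _ _ _ P Y indepY (fun=> g) (fun=> mg) (fun=> g0) qfin [:: j; i].
    rewrite /= inE eq_sym ij => /(_ isT); rewrite !big_cons big_nil mule1 !integral_tail => <-.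
    by apply: eq_integral => w _; rewrite !big_cons big_nil mulr1.
  rewrite -big_seq sum_const_ereal size_rem//.
  rewrite lee_wpmul2r ?mule_ge0 ?measure_ge0// lee_fin ler_nat; exact: leq_pred.
have terms : \int[P]_w (\sum_(j <- s) expR (l * y) *
      (g (Y j w) * \prod_(i <- rem j s) f (Y i w)))%:E <=
    (size s)%:R%:E * ((expR (l * y + z * (size s).-1%:R))%:E * q t).
  under eq_integral do rewrite -sumEFin.
  rewrite ge0_integral_sum//; [|by move=> j; apply/measurable_EFinP|by move=> *; rewrite lee_fin].
  rewrite -sum_const_ereal big_seq [leRHS]big_seq; apply: lee_sum => j sj.
  under eq_integral do rewrite EFinM.
  rewrite ge0_integralZl//; first last.
  - by move=> w _; rewrite lee_fin mulr_ge0// prodr_ge0.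
  - by apply/measurable_EFinP/measurable_funM.
  (* Jump indicator at [j], Laplace factor elsewhere: the mixed product becomes an instance of the
     product formula. *)
  pose fj i := if i == j then g else f.
  have mfj i : measurable_fun setT (fj i) by rewrite /fj; case: ifP.
  have fj0 i x : (0 <= fj i x)%R by rewrite /fj; case: ifP.
  have fjfin i : \int[P]_w (fj i (Y i w))%:E \is a fin_num by rewrite /fj; case: ifP.
  have jr : uniq (j :: rem j s) by rewrite /= mem_rem_uniq// inE eqxx rem_uniq.
  have fjr i : i \in rem j s -> fj i = f.
    by rewrite mem_rem_uniq// inE /fj => /andP[/negbTE ->].
  have -> : \int[P]_w (g (Y j w) * \prod_(i <- rem j s) f (Y i w))%:E =
      \int[P]_w (\prod_(i <- j :: rem j s) fj i (Y i w))%:E.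
    apply: eq_integral => w _; rewrite big_cons {1}/fj eqxx.
    by congr (_ * _)%:E; apply: eq_big_seq => i /fjr ->.
  rewrite (integral_prod_indep indepY mfj fj0 fjfin jr).
  rewrite big_cons {1}/fj eqxx integral_tail.
  rewrite (eq_big_seq (fun i => \int[P]_w (f (Y i w))%:E)); last by move=> i /fjr ->.
  rewrite expRD EFinM -muleA lee_pmul2l ?lte_fin ?expR_gt0// muleC.
  rewrite lee_wpmul2r ?measure_ge0// -(size_rem sj).
  exact: prod_const_le Mi (M0 0%N) Mz.
rewrite -lhs prob_integral; last exact: measurable_gt_sum.
apply: (@le_trans _ _ (\int[P]_w ((y + t < \sum_(i <- s) Y i w)%R%:R +
    \sum_(j <- s) \sum_(i <- rem j s) (g (Y j w) * g (Y i w)) +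
    \sum_(j <- s) expR (l * y) * (g (Y j w) * \prod_(i <- rem j s) f (Y i w)))%R%:E)).
  apply: ge0_le_integral => //.
  - by move=> w _; rewrite lee_fin sumr_ge0.
  - exact/measurable_EFinP/measurable_sum.
  - apply/measurable_EFinP/measurable_funD; last exact: measurable_sum.
    apply/measurable_funD; first by apply/measurable_bool_natr/measurable_gt_sum.
    by apply: measurable_sum => j; exact: measurable_sum.
  - by move=> w _; rewrite lee_fin; exact: single_jump_le.
under eq_integral do rewrite !EFinD.
rewrite ge0_integralD//=; first last.
- exact/measurable_EFinP/measurable_sum.
- by move=> w _; rewrite lee_fin sumr_ge0.
- apply: emeasurable_funD; first by apply/measurable_EFinP/measurable_bool_natr/measurable_gt_sum.
  by apply/measurable_EFinP/measurable_sum => j; exact: measurable_sum.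
- by move=> w _; rewrite adde_ge0// lee_fin// sumr_ge0// => j _; rewrite sumr_ge0.
rewrite ge0_integralD//=; first last.
- by apply/measurable_EFinP/measurable_sum => j; exact: measurable_sum.
- by move=> w _; rewrite lee_fin sumr_ge0// => j _; rewrite sumr_ge0.
- by apply/measurable_EFinP/measurable_bool_natr/measurable_gt_sum.
by rewrite leeD// leeD.
Qed.

End probability_bounds.

(** * Polynomial tail decay and finite moments *)

Section moments.
Context {d : measure_display} {T : measurableType d} {R : realType}.
Variables (P : probability T R) (X : {RV P >-> R}).
Hypothesis X_ge0 : forall w, 0 <= X w.

Definition tail (t : R) : R := fine (P [set w | t < X w]).

Lemma measurable_tail (t : R) : measurable [set w | t < X w].
Proof.
have mb : measurable_fun setT (fun w => t < X w).
  by apply: measurable_fun_ltr => //; exact: measurable_cst.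
by rewrite -[X in measurable X]setTI; exact: (mb measurableT [set true]).
Qed.

Lemma tailE (t : R) : P [set w | t < X w] = (tail t)%:E.
Proof. by rewrite fineK// fin_num_measure//; exact: measurable_tail. Qed.

Lemma tail_ge0 t : 0 <= tail t.
Proof. by rewrite -lee_fin -tailE measure_ge0. Qed.

Lemma tail_le1 t : tail t <= 1.
Proof. by rewrite -lee_fin -tailE probability_le1//; exact: measurable_tail. Qed.

Lemma tail_nincr : {homo tail : s t / s <= t >-> t <= s}.
Proof.
move=> s t st; rewrite -lee_fin -!tailE; apply: le_measure.
- by rewrite inE; exact: measurable_tail.
- by rewrite inE; exact: measurable_tail.
- by move=> w /=; exact: le_lt_trans.
Qed.

(** With [m] the integer part of [x^p], one has [m^(1/p) <= x] and [x^p <= 2 m], so monotonicity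
    gives the bound [2] for large [x]. For [x^p < N + 1] the tail is bounded by [1]. Both bounds lie
    below [N + 3]. *)
Lemma tail_polynomial p : 0 < p ->
  (\forall n \near \oo, n%:R * tail (n%:R `^ p^-1) <= 1) ->
  exists2 C, 0 <= C & forall x, 0 < x -> tail x * x `^ p <= C.
Proof.
move=> p_gt0 [N _ Ntail]; exists (N%:R + 3); first by rewrite addr_ge0.
move=> x x_gt0; have xp_gt0 : 0 < x `^ p by exact: powR_gt0.
have [xp_lt|xp_ge] := ltP (x `^ p) (N%:R + 1).
  apply: (@le_trans _ _ (1 * x `^ p)); last by lra.
  by rewrite ler_pM2r// tail_le1.
have N_ge0 : 0 <= N%:R :> R by [].
have xp_ge1 : 1 <= x `^ p by lra.
have [m_gt0 /andP[mx xm]] := trunc_double xp_ge1.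
set m := Num.trunc (x `^ p) in m_gt0 mx xm.
have Nm : (N <= m)%N.
  have /andP[_] := trunc_itv (ltW xp_gt0); rewrite -/m -natr1 => /(le_lt_trans xp_ge).
  by rewrite ltrD2r ltr_nat => /ltnW.
have mtail : m%:R * tail x <= 1.
  apply: le_trans (Ntail m Nm); rewrite ler_pM2l ?ltr0n//; apply: tail_nincr.
  have -> : x = (x `^ p) `^ p^-1 by rewrite -powRrM divff ?gt_eqF// powRr1// ltW.
  by rewrite ge0_ler_powR ?nnegrE ?invr_ge0 ?(ltW p_gt0) ?(ltW xp_gt0).
have := tail_ge0 x => tx; apply: (@le_trans _ _ (tail x * (m%:R * 2))).
  by rewrite ler_wpM2l.
by rewrite mulrCA mulrA; lra.
Qed.

(* The term of index [j = floor (ln x)] alone dominates [x `^ q] when [1 < x]. *)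
Lemma powR_le_exp_grid (q x : R) : 0 < q -> 0 <= x ->
  ((x `^ q)%:E <= 1 + \sum_(0 <= j <oo)
    (expR (q * (j%:R + 1)) * (expR (j%:R - 1) < x)%R%:R)%:E)%E.
Proof.
move=> q_gt0 x_ge0.
have term_ge0 (j : nat) : (0 <= (expR (q * (j%:R + 1)) * (expR (j%:R - 1) < x)%R%:R)%:E)%E.
  by rewrite lee_fin mulr_ge0 ?expR_ge0.
have [x_le1|x_gt1] := leP x 1.
  rewrite (@le_trans _ _ 1%E)//; last by rewrite leeDl// nneseries_ge0.
  rewrite lee_fin; have : x `^ q <= 1 `^ q by rewrite ge0_ler_powR ?nnegrE ?(ltW q_gt0).
  by rewrite powR1.
have x_gt0 : 0 < x by exact: lt_trans x_gt1.
have ln_ge0 : 0 <= ln x by rewrite ln_ge0// ltW.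
have /andP[jx xj] := trunc_itv ln_ge0; set j := Num.trunc _ in jx xj.
have jle : (\sum_(0 <= j < j.+1) (expR (q * (j%:R + 1)) * (expR (j%:R - 1) < x)%R%:R)%:E <=
  \sum_(0 <= j <oo) (expR (q * (j%:R + 1)) * (expR (j%:R - 1) < x)%R%:R)%:E)%E.
  exact: nneseries_lim_ge.
rewrite (le_trans _ (leeD (le_refl _) jle))//.
rewrite big_nat_recr//= addrA -[leLHS]add0e leeD//.
  by rewrite adde_ge0// sume_ge0.
have -> : expR (j%:R - 1) < x.
  by rewrite -[x]lnK// ltr_expR (lt_le_trans _ jx)// ltrBlDr ltrDl.
rewrite lee_fin mulr1 /powR gt_eqF// ler_expR ler_pM2l//.
by rewrite natr1 ltW.
Qed.

(** Integrating [powR_le_exp_grid] gives a series whose terms are at most [C * expR (q (j + 1) - p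
    (j - 1)) = a * z^j], geometric with ratio [expR (q - p) < 1]. *)
Lemma moment_finite (p q C : R) : 0 < q < p -> 0 <= C ->
  (forall x, 0 < x -> tail x * x `^ p <= C) ->
  exists2 K, 0 <= K & (\int[P]_w (X w `^ q)%:E <= K%:E)%E.
Proof.
move=> /andP[q_gt0 qp] C_ge0 tailC.
pose z := expR (q - p); have z_gt0 : 0 < z by exact: expR_gt0.
have z_lt1 : z < 1 by rewrite expR_lt1 subr_lt0.
pose a := C * expR (q + p); have a_ge0 : 0 <= a by rewrite mulr_ge0 ?expR_ge0.
exists (1 + a * (1 - z)^-1).
  by rewrite addr_ge0 ?mulr_ge0 ?invr_ge0 ?subr_ge0// ltW.
pose u (j : nat) w : \bar R := (expR (q * (j%:R + 1)) * (expR (j%:R - 1) < X w)%R%:R)%:E.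
have u_ge0 j w : (0 <= u j w)%E by rewrite lee_fin mulr_ge0 ?expR_ge0.
have mu j : measurable_fun setT (u j).
  apply/measurable_EFinP/measurable_funM => //.
  apply: measurable_bool_natr; apply: measurable_fun_ltr => //.
have mpow : measurable_fun setT (fun w => (X w `^ q)%:E).
  apply/measurable_EFinP.
  exact: (measurableT_comp (measurable_powR q) (measurable_funPT X)).
apply: (@le_trans _ _ (\int[P]_w (1 + \sum_(0 <= j <oo) u j w))%E).
  apply: ge0_le_integral => //.
  - by move=> w _; rewrite lee_fin powR_ge0.
  - by apply: emeasurable_funD => //; exact: ge0_emeasurable_sum.
  - by move=> w _; exact: powR_le_exp_grid.
rewrite ge0_integralD//=; first last.
- exact: ge0_emeasurable_sum.
- by move=> w _; exact: nneseries_ge0.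
rewrite EFinD leeD//.
  by rewrite (integral_cst P measurableT 1%E) mul1e probability_le1.
rewrite integral_nneseries//.
have int_u j : (\int[P]_w u j w <= (a * z ^+ j)%:E)%E.
  rewrite /u; under eq_integral do rewrite EFinM.
  rewrite ge0_integralZl ?lee_fin ?expR_ge0//=; last first.
    by apply/measurable_EFinP/measurable_bool_natr; apply: measurable_fun_ltr.
  rewrite -prob_integral; last by apply: measurable_fun_ltr.
  rewrite tailE -EFinM lee_fin.
  have := tailC _ (expR_gt0 (j%:R - 1)); rewrite -expRM => h.
  have {h} : tail (expR (j%:R - 1)) <= C * expR (- ((j%:R - 1) * p)).
    by rewrite expRN ler_pdivlMr ?expR_gt0.
  move=> /(ler_wpM2l (expR_ge0 (q * (j%:R + 1)))) /le_trans; apply.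
  rewrite /a /z -expRM_natl mulrCA -!mulrA -!expRD ler_wpM2l// ler_expR.
  by rewrite le_eqVlt; apply/orP; left; apply/eqP; ring.
apply: (@le_trans _ _ (\sum_(0 <= j <oo) (a * z ^+ j)%:E)%E).
  by apply: lee_nneseries => // j _ _; exact: integral_ge0.
apply: lime_le.
  by apply: is_cvg_nneseries => j _ _; rewrite lee_fin mulr_ge0// exprn_ge0// ltW.
apply: nearW => n; rewrite sumEFin lee_fin.
have := @geometric_le_lim _ n a z a_ge0 z_gt0.
by rewrite (ger0_norm (ltW z_gt0)) => /(_ z_lt1).
Qed.

End moments.

(** * Elementary estimates of the exponential *)

Section exponential_bounds.
Context {R : realType}.
Implicit Types (a b c l r x y : R).

(** As [1 - y <= expR (- y)], it is enough that [(1 - y) (1 + y + 2 y^2) = 1 + y^2 (1 - 2 y)] be at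
    least [1], whence the range [y <= 1 / 2]. *)
Lemma expR_le_quadratic y : 0 <= y -> y <= 1 / 2 -> expR y <= 1 + y + 2 * y ^+ 2.
Proof.
move=> y_ge0 y_le; have y1 : 0 < 1 - y by lra.
rewrite -(ler_pM2r y1); apply: (@le_trans _ _ 1); last by nra.
apply: (@le_trans _ _ (expR y * expR (- y))).
  by rewrite ler_pM2l ?expR_gt0//; exact: expR_ge1Dx.
by rewrite -expRD subrr expR0.
Qed.

Lemma expR_le_linear y : 0 <= y -> y <= 1 / 2 -> expR y <= 1 + 2 * y.
Proof. by move=> y_ge0 y_le; have := expR_le_quadratic y_ge0 y_le; nra. Qed.

(** For [y > 1] the right-hand side is at least [1] since [y <= y^r]. For [y <= 1] one has
    [y^2 <= y^r], and [expR (- y) <= 1 / (1 + y) <= 1 - y + y^2]. *)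
Lemma expRN_le_powR y r : 0 <= y -> 1 <= r <= 2 -> expR (- y) <= 1 - y + y `^ r.
Proof.
move=> y_ge0 /andP[r_ge1 r_le2]; have [y_le1|y_gt1] := leP y 1; last first.
  apply: (@le_trans _ _ 1); first by rewrite -expR0 ler_expR oppr_le0.
  have : y <= y `^ r by rewrite le1r_powR// ltW.
  by lra.
have [->|y_neq0] := eqVneq y 0; first by rewrite oppr0 expR0 addr0 lerDl powR_ge0.
have y_gt0 : 0 < y by rewrite lt_neqAle eq_sym y_neq0.
have y2 : y ^+ 2 <= y `^ r.
  by rewrite -powR_mulrn// ger_powR// y_gt0.
apply: (@le_trans _ _ (1 - y + y ^+ 2)); last by rewrite lerD2l.
have y1 : 0 < 1 + y by lra.
rewrite -(ler_pM2r y1); apply: (@le_trans _ _ 1).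
  apply: (@le_trans _ _ (expR (- y) * expR y)).
    by rewrite ler_pM2l ?expR_gt0//; exact: expR_ge1Dx.
  by rewrite -expRD addNr expR0.
have -> : (1 - y + y ^+ 2) * (1 + y) = 1 + y ^+ 3 by ring.
by rewrite lerDl exprn_ge0.
Qed.

Lemma near_exp_dominates a b (M : R) : b < a ->
  \forall n \near \oo, M * expR (b * ln n%:R) <= expR (a * ln n%:R).
Proof.
move=> ba; near=> n; rewrite -[a](subrK b) mulrDl expRD ler_pM2r ?expR_gt0//.
apply: le_trans (expR_ge1Dx _).
suff : M / (a - b) <= ln n%:R by rewrite ler_pdivrMr ?subr_gt0//; lra.
by near: n; exact: near_ln_ge.
Unshelve. all: by end_near. Qed.

Lemma near_exp_dominates_pow (k : nat) c (M : R) : 0 < c ->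
  \forall n \near \oo, M * ln n%:R ^+ k <= expR (c * ln n%:R).
Proof.
move=> c_gt0; near=> n.
have v_ge0 : 0 <= ln (n%:R : R) by near: n; exact: near_ln_ge.
have cv_ge0 : 0 <= c * ln n%:R by rewrite mulr_ge0// ltW.
apply: le_trans (expR_ge1Dxn k cv_ge0).
apply: (@le_trans _ _ ((c * ln n%:R) ^+ k.+1 / k.+1`!%:R)); last by rewrite lerDr.
have -> : (c * ln n%:R) ^+ k.+1 / k.+1`!%:R =
    ln n%:R ^+ k * (ln n%:R * (c ^+ k.+1 / k.+1`!%:R)).
  rewrite exprMn [ln _ ^+ k.+1]exprSr; move: (c ^+ k.+1) (ln _ ^+ k) (_^-1).
  by move=> x y z; ring.
rewrite mulrC ler_wpM2l ?exprn_ge0//.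
have : M / (c ^+ k.+1 / k.+1`!%:R) <= ln n%:R by near: n; exact: near_ln_ge.
rewrite ler_pdivrMr ?divr_gt0 ?exprn_gt0 ?ltr0n ?fact_gt0//.
Unshelve. all: by end_near. Qed.

(** For [u = x / expR c] in []0, 1]] this is [u^k <= u^q]: below the truncation level a high power
    is controlled by a moment of lower order. *)
Lemma truncated_pow_le (k : nat) (q c x : R) : (0 < k)%N -> q <= k%:R ->
  0 <= x -> x <= expR c ->
  x ^+ k <= expR c ^+ k * expR (- (c * q)) * x `^ q.
Proof.
move=> k_gt0 qk x_ge0 xc; have [->|x_neq0] := eqVneq x 0.
  by rewrite expr0n gtn_eqF// !mulr_ge0 ?exprn_ge0 ?expR_ge0 ?powR_ge0.
pose u := x * expR (- c).
have u_gt0 : 0 < u by rewrite mulr_gt0 ?expR_gt0// lt_neqAle eq_sym x_neq0.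
have u_le1 : u <= 1 by rewrite /u expRN ler_pdivrMr ?expR_gt0// mul1r.
have uq : u `^ q = expR (- (c * q)) * x `^ q.
  by rewrite powRM ?expR_ge0// -expRM mulNr mulrC.
have xu : x = u * expR c by rewrite /u -mulrA -expRD addNr expR0 mulr1.
rewrite {1}xu exprMn mulrC -mulrA -uq ler_pM2l ?exprn_gt0 ?expR_gt0//.
by rewrite -powR_mulrn ?(ltW u_gt0)// ger_powR// u_gt0.
Qed.

(** The idle [l * 0] and [^+ 1] give this bound the same shape as the quadratic one, with linear
    part [0] and [k = 1]. *)
Lemma truncated_exp_linear_le (q l c x : R) : q <= 1 -> 0 <= l ->
  l * expR c <= 1 / 2 -> 0 <= x ->
  expR (l * x) * (x <= expR c)%R%:R <=
    1 + l * 0 + 2 * (l * expR c) ^+ 1 * expR (- (c * q)) * x `^ q.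
Proof.
move=> q_le1 l_ge0 lc x_ge0; rewrite mulr0 addr0 expr1.
have [xc|_] := leP x (expR c); last first.
  by rewrite mulr0 addr_ge0// !mulr_ge0 ?expR_ge0 ?powR_ge0.
have lx : l * x <= 1 / 2 by rewrite (le_trans _ lc)// ler_wpM2l.
rewrite mulr1 (le_trans (expR_le_linear (mulr_ge0 l_ge0 x_ge0) lx))// lerD2l.
have := @truncated_pow_le 1 q c x isT q_le1 x_ge0 xc; rewrite !expr1.
by move=> /(ler_wpM2l l_ge0); rewrite !mulrA; lra.
Qed.

Lemma truncated_exp_quadratic_le (q l c x : R) : q <= 2 -> 0 <= l ->
  l * expR c <= 1 / 2 -> 0 <= x ->
  expR (l * x) * (x <= expR c)%R%:R <=
    1 + l * x + 2 * (l * expR c) ^+ 2 * expR (- (c * q)) * x `^ q.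
Proof.
move=> q_le2 l_ge0 lc x_ge0.
have [xc|_] := leP x (expR c); last first.
  by rewrite mulr0 addr_ge0 ?addr_ge0 ?mulr_ge0 ?exprn_ge0 ?mulr_ge0 ?expR_ge0 ?powR_ge0.
have lx : l * x <= 1 / 2 by rewrite (le_trans _ lc)// ler_wpM2l.
rewrite mulr1 (le_trans (expR_le_quadratic (mulr_ge0 l_ge0 x_ge0) lx))// lerD2l.
have := @truncated_pow_le 2 q c x isT q_le2 x_ge0 xc.
move=> /(ler_wpM2l (exprn_ge0 2 l_ge0)); rewrite !exprMn !mulrA; lra.
Qed.

End exponential_bounds.

(** * Choice of parameters along the scale [ln n] *)

Section deviations.
Context {d : measure_display} {T : measurableType d} {R : realType}.
Variables (P : probability T R) (Y : nat -> {RV P >-> R}).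
Hypothesis iidY : iid Y.
Hypothesis Y_ge0 : forall n w, 0 <= Y n w.
Variables (p m s : R).
Hypotheses (p_gt0 : 0 < p) (s_gt0 : 0 < s).

Let F := tail (Y 0%N).

(** One formula for both ranges of [p]: [m] is [0] below [p = 1] and the mean from there on. *)
Definition deviation (n : nat) : R := n%:R * m + s * n%:R `^ p^-1.

Definition dev_prob n : R :=
  fine (P [set w | deviation n < partial_sum Y n w]).

Lemma dev_probE n :
  P [set w | deviation n < partial_sum Y n w] = (dev_prob n)%:E.
Proof.
rewrite fineK// fin_num_measure//.
have mb := @measurable_gt_sum _ _ _ P Y (deviation n) (index_iota 1 n.+1).
by rewrite -[X in measurable X]setTI; exact: (mb measurableT [set true]).
Qed.

Lemma near_natrE : \forall n \near \oo,
  n%:R = expR (ln n%:R) :> R /\ n%:R `^ p^-1 = expR (p^-1 * ln n%:R).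
Proof.
near=> n; have n_gt0 : 0 < n%:R :> R by rewrite ltr0n; near: n; exact: nbhs_infty_gt.
by rewrite lnK// /powR gt_eqF.
Unshelve. all: by end_near. Qed.

Lemma near_dev_prob_le (k : nat) (b A q K : R) : 0 < b < 1 -> 0 <= K ->
  b * (k%:R - q) < k%:R - p ->
  (forall l c, 0 <= l -> l * expR c <= 1 / 2 ->
    (\int[P]_w (expR (l * Y 0%N w) * (Y 0%N w <= expR c)%R%:R)%:E <=
      (expR (l * m + 2 * (l * expR c) ^+ k * expR (- (c * q)) * K))%:E)%E) ->
  \forall n \near \oo, dev_prob n <=
    expR (ln n%:R) * F (expR (b / p * ln n%:R)) + expR (A * ln n%:R).
Proof.
move=> /andP[b_gt0 b_lt1] K_ge0 bkq mgf.
(* The Chernoff factor will be [n^(- s A')]; the extra unit pays for the moment error, which is at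
   most [1 <= v]. *)
have [A' A'_gt0 sA'] : exists2 A', 0 < A' & s * A' = `|A| + 1.
  exists ((`|A| + 1) / s); first by rewrite divr_gt0// ltr_wpDl.
  by field; rewrite gt_eqF.
(* Summed over [n] terms, the moment error is [2 K A'^k v^k n^(-e)]; the hypothesis [bkq] says that
   [e] is positive. *)
pose e := (k%:R - p - b * (k%:R - q)) / p.
have e_gt0 : 0 < e by rewrite divr_gt0// subr_gt0.
near=> n.
have [nE npE] : n%:R = expR (ln n%:R) :> R /\ n%:R `^ p^-1 = expR (p^-1 * ln n%:R).
  by near: n; exact: near_natrE.
have v_ge1 : 1 <= ln (n%:R : R) by near: n; exact: near_ln_ge.
have v_ge0 : 0 <= ln (n%:R : R) by exact: le_trans v_ge1.
have v_b : 2 * A' * ln n%:R ^+ 1 <= expR ((1 - b) / p * ln (n%:R : R)).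
  by near: n; apply: near_exp_dominates_pow; rewrite divr_gt0// subr_gt0.
have v_e : 2 * K * A' ^+ k * ln n%:R ^+ k <= expR (e * ln (n%:R : R)).
  by near: n; exact: near_exp_dominates_pow.
set v := ln n%:R in nE npE v_ge1 v_ge0 v_b v_e *.
pose l := A' * v * expR (- (p^-1 * v)).
have l_ge0 : 0 <= l by rewrite mulr_ge0 ?expR_ge0// mulr_ge0// (ltW A'_gt0).
pose c := b / p * v.
have lc : l * expR c = A' * v * expR (- ((1 - b) / p * v)).
  by rewrite /l /c -mulrA -expRD; congr (_ * expR _); ring.
have lc_le : l * expR c <= 1 / 2.
  rewrite lc expRN ler_pdivrMr ?expR_gt0//; move: v_b; rewrite expr1; lra.
have us : uniq (index_iota 1 n.+1) by exact: iota_uniq.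
have := prob_sum_le iidY (deviation n) us l_ge0 (mgf _ _ l_ge0 lc_le).
rewrite -[X in P X]/[set w | deviation n < partial_sum Y n w].
rewrite size_iota subn1 /= dev_probE tailE -EFinM -EFinD lee_fin => /le_trans; apply.
rewrite nE lerD2l ler_expR /deviation npE nE.
have -> : - (l * (expR v * m + s * expR (p^-1 * v))) +
    (l * m + 2 * (l * expR c) ^+ k * expR (- (c * q)) * K) * expR v =
    2 * K * ((l * expR c) ^+ k * expR (- (c * q)) * expR v) -
      s * (l * expR (p^-1 * v)) by ring.
have -> : l * expR (p^-1 * v) = A' * v by rewrite /l -mulrA -expRD addNr expR0 mulr1.
have -> : (l * expR c) ^+ k * expR (- (c * q)) * expR v =
    A' ^+ k * v ^+ k * expR (- (e * v)).
  rewrite lc !exprMn -expRM_natl -!mulrA -!expRD; congr (_ * (_ * expR _)).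
  by rewrite /e /c; field; rewrite gt_eqF.
have : 2 * K * (A' ^+ k * v ^+ k * expR (- (e * v))) <= 1.
  by rewrite expRN !mulrA ler_pdivrMr ?expR_gt0// mul1r.
have -> : s * (A' * v) = (`|A| + 1) * v by rewrite mulrA sA'.
have : - A * v <= `|A| * v by rewrite ler_wpM2r// -normrN ler_norm.
lra.
Unshelve. all: by end_near. Qed.

(** The bound [- 3] ensures [expR (- 3) <= 1 / 4], read off from [1 + 3 <= expR 3]. Since also
    [(n F)^2 <= n F / 4], half of [n F] survives in [prob_sum_ge]. *)
Lemma near_dev_prob_ge (b : R) : 1 < b ->
  (\forall n \near \oo, n%:R * F (n%:R `^ p^-1) <= 1 / 4) ->
  (\forall n \near \oo, exists l z, [/\ 0 <= l,
    (\int[P]_w (expR (- (l * Y 0%N w)))%:E <= (expR z)%:E)%E &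
    l * (deviation n - expR (b / p * ln n%:R)) + z * n.-1%:R <= - 3]) ->
  \forall n \near \oo,
    expR (ln n%:R) * F (expR (b / p * ln n%:R)) / 2 <= dev_prob n.
Proof.
move=> b_gt1 Fn mgf; near=> n.
have [nE npE] : n%:R = expR (ln n%:R) :> R /\ n%:R `^ p^-1 = expR (p^-1 * ln n%:R).
  by near: n; exact: near_natrE.
have v_ge0 : 0 <= ln (n%:R : R) by near: n; exact: near_ln_ge.
have [l [z [l_ge0 Mz lyz]]] : exists l z, [/\ 0 <= l,
    (\int[P]_w (expR (- (l * Y 0%N w)))%:E <= (expR z)%:E)%E &
    l * (deviation n - expR (b / p * ln n%:R)) + z * n.-1%:R <= - 3] by near: n.
have us : uniq (index_iota 1 n.+1) by exact: iota_uniq.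
set t := expR (b / p * ln n%:R) in lyz *.
have := prob_sum_ge iidY t (deviation n - t) us l_ge0 Mz.
rewrite size_iota subn1 /= subrK.
rewrite -[X in (_ <= P X + _ + _)%E]/[set w | deviation n < partial_sum Y n w].
rewrite dev_probE tailE -!EFinM -!EFinD lee_fin -/F -nE.
have nF_le : n%:R * F t <= 1 / 4.
  have : n%:R * F (n%:R `^ p^-1) <= 1 / 4 by near: n.
  apply: le_trans; rewrite ler_wpM2l//; apply: tail_nincr.
  rewrite npE ler_expR ler_wpM2r// -[leLHS]mul1r ler_wpM2r ?invr_ge0 ?(ltW p_gt0)//.
  exact: ltW.
have nF_ge0 : 0 <= n%:R * F t by rewrite mulr_ge0// tail_ge0.
have exp3 : expR (l * (deviation n - t) + z * n.-1%:R) <= 1 / 4.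
  apply: (@le_trans _ _ (expR (- 3))); first by rewrite ler_expR.
  rewrite expRN invf_ple ?posrE ?expR_gt0//.
  by apply: le_trans (expR_ge1Dx 3); lra.
move: exp3; set E := expR _ => E_le.
have -> : n%:R * (n%:R * (F t * F t)) = (n%:R * F t) * (n%:R * F t) by ring.
have -> : n%:R * (E * F t) = E * (n%:R * F t) by ring.
move: nF_le nF_ge0; set x := n%:R * F t => x_le x_ge0.
have : x * x <= 1 / 4 * x by rewrite ler_wpM2r.
have : E * x <= 1 / 4 * x by rewrite ler_wpM2r.
lra.
Unshelve. all: by end_near. Qed.

End deviations.

(** * Exponential moments of one variable from its power moments *)

Section laplace_transforms.
Context {d : measure_display} {T : measurableType d} {R : realType}.
Variables (P : probability T R) (X : {RV P >-> R}).
Hypothesis X_ge0 : forall w, 0 <= X w.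
Variables (q K : R).
Hypothesis moment_le : (\int[P]_w (X w `^ q)%:E <= K%:E)%E.

Let mpow : measurable_fun setT (fun w => X w `^ q).
Proof. exact: (measurableT_comp (measurable_powR q) (measurable_funPT X)). Qed.

(** Here [e] is the first-order part of the expansion. Closing with [1 + u <= expR u] puts the bound
    in the form required for an [n]-fold product. *)
Lemma integral_le_expR (h e : R -> R) (l D m : R) :
  measurable_fun setT h -> (forall x, 0 <= h x) ->
  measurable_fun setT e -> (forall x, 0 <= x -> 0 <= e x) -> 0 <= l -> 0 <= D ->
  (forall x, 0 <= x -> h x <= 1 + l * e x + D * x `^ q) ->
  (\int[P]_w (e (X w))%:E <= m%:E)%E ->
  (\int[P]_w (h (X w))%:E <= (expR (l * m + D * K))%:E)%E.
Proof.
move=> mh h0 me e0 l0 D0 hle int_e.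
have mhX : measurable_fun setT (fun w => h (X w)).
  exact: (measurableT_comp mh (measurable_funPT X)).
have meX : measurable_fun setT (fun w => e (X w)).
  exact: (measurableT_comp me (measurable_funPT X)).
have eX0 w : 0 <= e (X w) by exact: e0.
apply: (@le_trans _ _ (\int[P]_w (1 + l%:E * (e (X w))%:E + D%:E * (X w `^ q)%:E))%E).
  apply: ge0_le_integral => //.
  - by move=> w _; rewrite lee_fin.
  - exact/measurable_EFinP.
  - apply: emeasurable_funD; last by apply/measurable_EFinP/measurable_funM.
    by apply: emeasurable_funD => //; apply/measurable_EFinP/measurable_funM.
  - by move=> w _; rewrite -!EFinM -!EFinD lee_fin; exact: hle.
have le0 w : (0 <= l%:E * (e (X w))%:E)%E by rewrite mule_ge0 ?lee_fin.
have De0 w : (0 <= D%:E * (X w `^ q)%:E)%E by rewrite mule_ge0 ?lee_fin ?powR_ge0.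
rewrite ge0_integralD//=; first last.
- by apply/measurable_EFinP/measurable_funM.
- by apply: emeasurable_funD => //; apply/measurable_EFinP/measurable_funM.
- by move=> w _; rewrite adde_ge0.
rewrite ge0_integralD//=; last by apply/measurable_EFinP/measurable_funM.
rewrite (integral_cst P measurableT 1%E) mul1e.
rewrite ge0_integralZl//; [|exact/measurable_EFinP|by move=> w _; rewrite lee_fin].
rewrite ge0_integralZl//; [|exact/measurable_EFinP|by move=> w _; rewrite lee_fin powR_ge0].
apply: (@le_trans _ _ (1 + l%:E * m%:E + D%:E * K%:E)%E).
  by rewrite !leeD ?probability_le1// lee_wpmul2l.
by rewrite -!EFinM -!EFinD lee_fin -addrA expR_ge1Dx.
Qed.

(** [expRN_le_powR] is integrated with its linear term moved to the left, which keeps every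
    integrand nonnegative; the real number [l * mu] is subtracted afterwards. *)
Lemma laplace_le (mu l : R) : 1 <= q <= 2 -> 0 <= l ->
  ('E_P[X] = mu%:E)%E ->
  (\int[P]_w (expR (- (l * X w)))%:E <= (expR (- (l * mu) + l `^ q * K))%:E)%E.
Proof.
move=> q12 l0; rewrite expectation_def => EX.
have mX : measurable_fun setT (fun w => (l * X w)%:E).
  by apply/measurable_EFinP/measurable_funM.
have mexp : measurable_fun setT (fun w => (expR (- (l * X w)))%:E).
  apply/measurable_EFinP; apply: measurableT_comp => //.
  by apply: measurableT_comp => //; exact: measurable_funM.
have lin : (\int[P]_w (l * X w)%:E = (l * mu)%:E)%E.
  under eq_integral do rewrite EFinM.
  by rewrite ge0_integralZl// ?EX//; [exact/measurable_EFinP|move=> w _; rewrite lee_fin].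
have : (\int[P]_w (expR (- (l * X w)))%:E + \int[P]_w (l * X w)%:E <=
    1 + (l `^ q)%:E * K%:E)%E.
  rewrite -ge0_integralD//; last by move=> w _; rewrite lee_fin mulr_ge0.
  apply: (@le_trans _ _ (\int[P]_w (1 + (l `^ q)%:E * (X w `^ q)%:E))%E).
    apply: ge0_le_integral => //.
    - by move=> w _; rewrite adde_ge0// lee_fin ?expR_ge0// mulr_ge0.
    - exact: emeasurable_funD.
    - by apply: emeasurable_funD => //; apply/measurable_EFinP/measurable_funM.
    - move=> w _; rewrite -EFinM -!EFinD lee_fin -powRM//.
      by have := expRN_le_powR (mulr_ge0 l0 (X_ge0 w)) q12; lra.
  rewrite ge0_integralD//; [|by move=> w _; rewrite mule_ge0// lee_fin powR_ge0
    |by apply/measurable_EFinP/measurable_funM].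
  rewrite (integral_cst P measurableT 1%E) mul1e leeD ?probability_le1//.
  rewrite ge0_integralZl//; [|exact/measurable_EFinP|by move=> w _; rewrite lee_fin powR_ge0
    |by rewrite lee_fin powR_ge0].
  by rewrite lee_wpmul2l// lee_fin powR_ge0.
rewrite lin -EFinM -EFinD -leeBrDr// => /le_trans; apply.
rewrite -EFinB lee_fin; apply: le_trans (expR_ge1Dx _); lra.
Qed.

End laplace_transforms.

(** * Affine change of exponents, infinite values included *)

Section rates.
Context {R : realType}.
Local Open Scope ereal_scope.

Lemma rate_exponentE (p : R) (x : \bar R) : (0 < p)%R ->
  1 + (p^-1)%:E * x = - ((- x - p%:E) * (p^-1)%:E).
Proof.
move=> p_gt0; have p_inv : (0 < p^-1)%R by rewrite invr_gt0.
case: x => [x| |].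
- suff E : (1 + p^-1 * x = - ((- x - p) * p^-1))%R by exact: (congr1 (@EFin R) E).
  by field; rewrite gt_eqF.
- by rewrite mulry gtr0_sg// mul1e addey// addNye mulNyr gtr0_sg// mul1e.
- by rewrite mulrNy gtr0_sg// mul1e addeNy/= addye// mulyr gtr0_sg// mul1e.
Qed.

Lemma rate_exponent_inj (p : R) : (0 < p)%R ->
  injective (fun x : \bar R => - ((x - p%:E) * (p^-1)%:E)).
Proof.
move=> p_gt0 x y /oppe_inj; rewrite ![_ * (p^-1)%:E]muleC => h.
have pinv_neq0 : (p^-1)%:E != 0 :> \bar R by rewrite eqe invr_eq0 gt_eqF.
have : x - p%:E = y - p%:E.
  have pK z : p%:E * ((p^-1)%:E * z) = z.
    by rewrite muleA -EFinM divff ?gt_eqF// mul1e.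
  by rewrite -[LHS]pK h pK.
by move=> /(congr1 (fun z => z + p%:E)); rewrite !subeK.
Qed.

Lemma cvg_rate_iff (p : R) (u : (\bar R)^nat) (a b c : \bar R) : (0 < p)%R ->
  limn_esup u = - ((a - p%:E) * (p^-1)%:E) ->
  limn_einf u = - ((b - p%:E) * (p^-1)%:E) ->
  u @ \oo --> - ((c - p%:E) * (p^-1)%:E) <-> a = c /\ b = c.
Proof.
move=> p_gt0 usup uinf; split=> [|[<- ba]]; last first.
  by apply: limn_esup_einf_cvg => //; rewrite uinf ba.
move=> /cvg_limn_einf_sup[]; rewrite usup uinf => bc ac.
by split; exact: (rate_exponent_inj p_gt0).
Qed.

End rates.

(** * The two inequalities for each range of [p], and the limits *)

Section large_deviations.
Context {d : measure_display} {T : measurableType d} {R : realType}.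
Variables (P : probability T R) (Y : nat -> {RV P >-> R}).
Hypothesis iidY : iid Y.
Hypothesis Y_ge0 : forall n w, 0 <= Y n w.
Variables (p m s : R).
Hypotheses (p_gt0 : 0 < p) (s_gt0 : 0 < s).

Let F := tail (Y 0%N).

Lemma log_tail_rateE t :
  log_tail_rate (Y 0%N) t = ((t^-1)%:E * lne (F (expR t))%:E)%E.
Proof.
rewrite /log_tail_rate -tailE; congr (_ * lne (P _))%E.
apply/seteqP; split=> w /=; have [Y_le0|Y_gt0] := leP (Y 0%N w) 0 => //=.
- by rewrite lte_fin => h; rewrite -[ltRHS]lnK ?posrE// ltr_expR.
- by move=> /(lt_trans (expR_gt0 t)); rewrite ltNge Y_le0.
- by move=> h; rewrite lte_fin -ltr_expR lnK.
Qed.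

Lemma near_tail_small (e : R) : 0 < e ->
  ((fun n : nat => ((n%:R : R)%:E * P [set w | (n%:R `^ p^-1 < Y 0%N w)%R])%E)
        @ \oo --> 0%E) ->
  \forall n \near \oo, n%:R * F (n%:R `^ p^-1) <= e.
Proof.
move=> e_gt0 /fine_cvgP[_ /cvgr_le/(_ e e_gt0)]; apply: filterS => n /=.
by rewrite tailE.
Qed.

Lemma log_dev_rate_lim :
  (forall b A, 0 < b < 1 -> \forall n \near \oo, dev_prob Y p m s n <=
    expR (ln n%:R) * F (expR (b / p * ln n%:R)) + expR (A * ln n%:R)) ->
  (forall b, 1 < b -> \forall n \near \oo,
    expR (ln n%:R) * F (expR (b / p * ln n%:R)) / 2 <= dev_prob Y p m s n) ->
  limn_esup (log_dev_rate Y (deviation p m s)) =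
    (- ((alpha_bar (Y 0%N) - p%:E) * (p^-1)%:E))%E /\
  limn_einf (log_dev_rate Y (deviation p m s)) =
    (- ((alpha_low (Y 0%N) - p%:E) * (p^-1)%:E))%E.
Proof.
move=> Q_le Q_ge; pose G t := F (expR t).
have Gn : {homo G : s t / s <= t >-> t <= s}.
  by move=> a b ab; apply: tail_nincr; rewrite ler_expR.
have -> : log_dev_rate Y (deviation p m s) =
    fun n => (((ln (n%:R : R))^-1)%:E * lne (dev_prob Y p m s n)%:E)%E.
  by apply/funext => n; rewrite /log_dev_rate dev_probE.
rewrite /alpha_bar /alpha_low.
have -> : log_tail_rate (Y 0%N) = fun t => ((t^-1)%:E * lne (G t)%:E)%E.
  by apply/funext => t; exact: log_tail_rateE.
split; rewrite -rate_exponentE//.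
  exact: (limn_esup_rate p_gt0 Gn Q_le Q_ge).
exact: (limn_einf_rate p_gt0 Gn Q_le Q_ge).
Qed.

(** At [q = p] the condition reads [b (k - p) < k - p], true as [b < 1], so there is room below [p].
    Solved for [q], it is [q > k - (k - p) / b]; when this threshold is negative, [p / 2] will
    do. *)
Lemma subcritical_moment (k b : R) : p < k -> 0 < b < 1 ->
  exists2 q : R, 0 < q < p & b * (k - q) < k - p.
Proof.
move=> pk /andP[b_gt0 b_lt1].
have kb : k - (k - p) / b < p.
  suff : k - p < (k - p) / b by lra.
  by rewrite ltr_pdivlMr// -[ltRHS]mulr1 ltr_pM2l// subr_gt0.
have [c0|c0] := leP 0 (k - (k - p) / b).
- exists ((k - (k - p) / b + p) / 2); first by apply/andP; split; lra.
  by rewrite mulrC -ltr_pdivlMr//; lra.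
- exists (p / 2); first by rewrite divr_gt0//= ltr_pdivrMr// mulr_natr mulr2n ltrDl.
  by rewrite mulrC -ltr_pdivlMr//; lra.
Qed.

(** Common to both ranges of [p]: [k = 1] with [e = 0] and [m = 0], or [k = 2] with [e] the identity
    and [m] the mean. *)
Lemma near_dev_prob_le_of_moments (k : nat) (e : R -> R) : p < k%:R -> (0 < k)%N ->
  measurable_fun setT e -> (forall x, 0 <= x -> 0 <= e x) ->
  (\int[P]_w (e (Y 0%N w))%:E <= m%:E)%E ->
  (forall q l c x, q <= k%:R -> 0 <= l -> l * expR c <= 1 / 2 -> 0 <= x ->
    expR (l * x) * (x <= expR c)%R%:R <=
      1 + l * e x + 2 * (l * expR c) ^+ k * expR (- (c * q)) * x `^ q) ->
  (\forall n \near \oo, n%:R * F (n%:R `^ p^-1) <= 1) ->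
  forall b A, 0 < b < 1 -> \forall n \near \oo, dev_prob Y p m s n <=
    expR (ln n%:R) * F (expR (b / p * ln n%:R)) + expR (A * ln n%:R).
Proof.
move=> pk k_gt0 me e_ge0 int_e trunc_le tail1 b A b01.
have [q /andP[q_gt0 qp] bkq] := subcritical_moment pk b01.
have [C C_ge0 tailC] := tail_polynomial p_gt0 tail1.
have q0p : 0 < q < p by rewrite q_gt0.
have [K K_ge0 momentK] := moment_finite (Y_ge0 0%N) q0p C_ge0 tailC.
apply: (near_dev_prob_le iidY p_gt0 s_gt0 A b01 K_ge0 bkq) => l c l_ge0 lc.
have D_ge0 : 0 <= 2 * (l * expR c) ^+ k * expR (- (c * q)).
  by rewrite !mulr_ge0 ?exprn_ge0 ?mulr_ge0 ?expR_ge0.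
pose h (x : R) := expR (l * x) * (x <= expR c)%R%:R.
apply: (integral_le_expR (Y_ge0 0%N) momentK (h := h) _ _ me e_ge0 l_ge0 D_ge0 _ int_e).
- apply: measurable_funM; last exact: measurable_le_natr.
  by apply: measurableT_comp => //; exact: measurable_funM.
- by move=> x; rewrite mulr_ge0 ?expR_ge0.
- move=> x x_ge0; apply: trunc_le => //.
  by rewrite (le_trans (ltW qp))// ltW.
Qed.

(* Since the variables are nonnegative, one summand exceeding the whole
   deviation is enough; no control of the other ones is needed. *)
Lemma near_dev_prob_ge_of_gap (b : R) : 1 < b ->
  (\forall n \near \oo, n%:R * F (n%:R `^ p^-1) <= 1 / 4) ->
  (\forall n \near \oo, deviation p m s n + 1 <= expR (b / p * ln n%:R)) ->
  \forall n \near \oo,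
    expR (ln n%:R) * F (expR (b / p * ln n%:R)) / 2 <= dev_prob Y p m s n.
Proof.
move=> b_gt1 tail4 gap; apply: near_dev_prob_ge => //.
(* The Laplace transform is at most [1 = expR 0], and a gap of at least [1] times [l = 3] gives the
   required [- 3]. *)
apply: filterS gap => n gap; exists 3, 0; split=> //; last first.
  by rewrite mul0r addr0; move: gap; set D := deviation _ _ _ _; set t := expR _ => ?; lra.
rewrite expR0; apply: (@le_trans _ _ (\int[P]_w 1)%E).
  apply: ge0_le_integral => //.
  - apply/measurable_EFinP; apply: measurableT_comp => //.
    by apply: measurableT_comp => //; exact: measurable_funM.
  - by move=> w _; rewrite lee_fin -expR0 ler_expR oppr_le0 mulr_ge0.
by rewrite (integral_cst P measurableT 1%E) mul1e probability_le1.
Qed.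

(** The jump [n^(b/p)] may be smaller than [n m], so the other summands must supply about
    [(n - 1) m]. Their shortfall is of order [n^(1/q)], negligible against the jump because
    [1 / q < b / p]. *)
Lemma near_dev_prob_ge_of_mean (b q K : R) : 1 < b -> 1 <= q <= 2 -> p / b < q ->
  ('E_P[Y 0%N] = m%:E)%E -> (\int[P]_w (Y 0%N w `^ q)%:E <= K%:E)%E ->
  0 <= K -> 0 <= m ->
  (\forall n \near \oo, n%:R * F (n%:R `^ p^-1) <= 1 / 4) ->
  \forall n \near \oo,
    expR (ln n%:R) * F (expR (b / p * ln n%:R)) / 2 <= dev_prob Y p m s n.
Proof.
move=> b_gt1 q12 pbq EY momentK K_ge0 m_ge0 tail4; apply: near_dev_prob_ge => //.
have q_gt0 : 0 < q by move: q12 => /andP[q1 _]; exact: lt_le_trans q1.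
have b_gt0 : 0 < b by exact: lt_trans b_gt1.
have bp1 : p^-1 < b / p by rewrite -[ltLHS]mul1r ltr_pM2r ?invr_gt0.
have bpq : q^-1 < b / p.
  rewrite -[ltLHS]mul1r ltr_pdivrMr// mulrAC ltr_pdivlMr// mul1r.
  by rewrite ltr_pdivrMr// mulrC in pbq *.
near=> n.
have [nE npE] : n%:R = expR (ln n%:R) :> R /\ n%:R `^ p^-1 = expR (p^-1 * ln n%:R).
  by near: n; exact: near_natrE.
have n_gt0 : 0 < n%:R :> R by rewrite nE expR_gt0.
(* One third of [n^(b/p)] each for the term [s n^(1/p)], for the moment error together with the
   required [3], and for the one mean left over by [n - 1] summands. *)
have dom1 : 3 * s * expR (p^-1 * ln n%:R) <= expR (b / p * ln (n%:R : R)).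
  by near: n; exact: near_exp_dominates.
have dom2 : 3 * (K + 3) * expR (q^-1 * ln n%:R) <= expR (b / p * ln (n%:R : R)).
  by near: n; exact: near_exp_dominates.
have dom3 : 3 * m * expR (0 * ln n%:R) <= expR (b / p * ln (n%:R : R)).
  by near: n; apply: near_exp_dominates; rewrite divr_gt0.
rewrite mul0r expR0 mulr1 in dom3.
(* With [l = n^(-1/q)] the error [l^q K] is [K / n], hence at most [K] in total. *)
pose l := expR (- (q^-1 * ln (n%:R : R))).
have l_gt0 : 0 < l by exact: expR_gt0.
have lq : l `^ q = n%:R^-1.
  rewrite -expRM mulNr mulrAC mulVf ?gt_eqF// mul1r expRN.
  by rewrite -nE.
exists l, (- (l * m) + l `^ q * K); split; first exact: ltW.
  exact: (laplace_le (Y_ge0 0%N) momentK q12 (ltW l_gt0) EY).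
rewrite lq /deviation npE.
set t := expR (b / p * _) in dom1 dom2 dom3 *.
set x := expR (p^-1 * _) in dom1 *.
have predn : n.-1%:R = n%:R - 1 :> R.
  by rewrite -subn1 natrB// -(ltr0n R).
rewrite predn.
have -> : l * (n%:R * m + s * x - t) + (- (l * m) + n%:R^-1 * K) * (n%:R - 1) =
    l * (m + s * x - t) + K - n%:R^-1 * K by field; rewrite gt_eqF.
have Kn : 0 <= n%:R^-1 * K by rewrite mulr_ge0 ?invr_ge0// ltW.
have lE : l * expR (q^-1 * ln n%:R) = 1 by rewrite -expRD addNr expR0.
have : K + 3 <= l * (t - m - s * x).
  have -> : K + 3 = l * ((K + 3) * expR (q^-1 * ln n%:R)) by rewrite mulrCA lE mulr1.
  rewrite ler_pM2l//.
  by move: dom1 dom2 dom3; set y := expR _ => ? ? ?; lra.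
have -> : l * (m + s * x - t) = - (l * (t - m - s * x)) by ring.
lra.
Unshelve. all: by end_near. Qed.

(** For [p = 1] tail decay only yields orders below [1], so the mean itself serves, with [q = 1].
    For [p > 1] any [q] between the larger of [1] and [p / b] and [p] works; a midpoint is taken. *)
Lemma mean_moment (b : R) : 1 <= p < 2 -> 1 < b -> 0 < m ->
  ('E_P[Y 0%N] = m%:E)%E ->
  (\forall n \near \oo, n%:R * F (n%:R `^ p^-1) <= 1) ->
  exists2 q : R, 1 <= q <= 2 & p / b < q /\
    exists2 K : R, 0 <= K & (\int[P]_w (Y 0%N w `^ q)%:E <= K%:E)%E.
Proof.
move=> /andP[p_ge1 p_lt2] b_gt1 m_gt0 EY tail1.
have b_gt0 : 0 < b by exact: lt_trans b_gt1.
have pb : p / b < p by rewrite ltr_pdivrMr// -[ltLHS]mulr1 ltr_pM2l.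
move: p_ge1; rewrite le_eqVlt => /predU1P[p1|p_gt1].
  exists 1; first by rewrite lexx ler1n.
  split; first by rewrite p1.
  exists m; first exact: ltW.
  by under eq_integral do rewrite powRr1//; rewrite -EY expectation_def.
have [q q_gt1 [qp pbq]] : exists2 q : R, 1 < q & q < p /\ p / b < q.
  have [?|?] := leP (p / b) 1.
    by exists ((1 + p) / 2); [lra|split; lra].
  by exists ((p / b + p) / 2); [lra|split; lra].
have [C C_ge0 tailC] := tail_polynomial p_gt0 tail1.
have q0p : 0 < q < p by rewrite qp (lt_trans _ q_gt1).
exists q; first by apply/andP; split; lra.
by split=> //; exact: (moment_finite (Y_ge0 0%N) q0p C_ge0 tailC).
Qed.

End large_deviations.

(* X = Y 0, X_n = Y n (n >= 1) *)
Theorem theorem2p3 (d : measure_display) (T : measurableType d) (R : realType)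
  (P : probability T R) (Y : nat -> {RV P >-> R}) :
  iid Y -> (forall n w, 0 <= Y n w) ->
  (* (i) *)
  (forall p : R, 0 < p < 1 ->
     ((fun n : nat => ((n%:R : R)%:E * P [set w | (n%:R `^ p^-1 < Y 0%N w)%R])%E)
        @ \oo --> 0%E) ->
     (forall s : R, 0 < s ->
        limn_esup (log_dev_rate Y (fun n => s * n%:R `^ p^-1))
          = (- ((alpha_bar (Y 0%N) - p%:E) * (p^-1)%:E))%E /\
        limn_einf (log_dev_rate Y (fun n => s * n%:R `^ p^-1))
          = (- ((alpha_low (Y 0%N) - p%:E) * (p^-1)%:E))%E) /\
     (forall (s : R) (ah : \bar R), 0 < s -> (0 <= ah)%E ->
        (log_dev_rate Y (fun n => s * n%:R `^ p^-1) @ \oo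
           --> (- ((ah - p%:E) * (p^-1)%:E))%E)
        <-> (alpha_bar (Y 0%N) = ah /\ alpha_low (Y 0%N) = ah))) /\
  (* (ii) *)
  (forall (p mu : R), 1 <= p < 2 -> 0 < mu ->
     ('E_P[Y 0%N] = mu%:E)%E ->
     ((fun n : nat => ((n%:R : R)%:E * P [set w | (n%:R `^ p^-1 < Y 0%N w)%R])%E)
        @ \oo --> 0%E) ->
     (forall s : R, 0 < s ->
        limn_esup (log_dev_rate Y (fun n => n%:R * mu + s * n%:R `^ p^-1))
          = (- ((alpha_bar (Y 0%N) - p%:E) * (p^-1)%:E))%E /\
        limn_einf (log_dev_rate Y (fun n => n%:R * mu + s * n%:R `^ p^-1))
          = (- ((alpha_low (Y 0%N) - p%:E) * (p^-1)%:E))%E) /\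
     (forall (s : R) (ah : \bar R), 0 < s -> (0 <= ah)%E ->
        (log_dev_rate Y (fun n => n%:R * mu + s * n%:R `^ p^-1) @ \oo
           --> (- ((ah - p%:E) * (p^-1)%:E))%E)
        <-> (alpha_bar (Y 0%N) = ah /\ alpha_low (Y 0%N) = ah))).
Proof.
move=> iidY Y_ge0; split=> [p /andP[p_gt0 p_lt1] tail0|p mu p12 mu_gt0 EY tail0].
  have lims s : 0 < s -> limn_esup (log_dev_rate Y (fun n => s * n%:R `^ p^-1))
          = (- ((alpha_bar (Y 0%N) - p%:E) * (p^-1)%:E))%E /\
        limn_einf (log_dev_rate Y (fun n => s * n%:R `^ p^-1))
          = (- ((alpha_low (Y 0%N) - p%:E) * (p^-1)%:E))%E.
    move=> s_gt0.
    have -> : (fun n => s * n%:R `^ p^-1) = deviation p 0 s.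
      by apply/funext => n; rewrite /deviation mulr0 add0r.
    apply: log_dev_rate_lim => //.
    - apply: (@near_dev_prob_le_of_moments _ _ _ _ _ iidY Y_ge0 _ _ _ p_gt0 s_gt0
        1 (fun=> 0)) => //.
      + by rewrite integral0.
      + by move=> q l c x; exact: truncated_exp_linear_le.
      + exact: near_tail_small.
    - move=> b b_gt1; have bp : p^-1 < b / p by rewrite -[ltLHS]mul1r ltr_pM2r ?invr_gt0.
      apply: near_dev_prob_ge_of_gap => //; first exact: near_tail_small.
      near=> n; rewrite /deviation mulr0 add0r.
      have [_ ->] : n%:R = expR (ln n%:R) :> R /\ n%:R `^ p^-1 = expR (p^-1 * ln n%:R).
        by near: n; exact: near_natrE.
      (* Half of [n^(b/p)] absorbs the deviation, the other half the gap [1]. *)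
      have dom1 : 2 * s * expR (p^-1 * ln n%:R) <= expR (b / p * ln (n%:R : R)).
        by near: n; exact: near_exp_dominates.
      have dom2 : 2 * expR (0 * ln n%:R) <= expR (b / p * ln (n%:R : R)).
        by near: n; apply: near_exp_dominates; rewrite divr_gt0// (lt_trans _ b_gt1).
      rewrite mul0r expR0 mulr1 in dom2; lra.
  split=> // s ah s_gt0 _; have [usup uinf] := lims s s_gt0.
  exact: cvg_rate_iff p_gt0 usup uinf.
have p_gt0 : 0 < p by move: p12 => /andP[p1 _]; exact: lt_le_trans p1.
have lims s : 0 < s ->
    limn_esup (log_dev_rate Y (fun n => n%:R * mu + s * n%:R `^ p^-1))
          = (- ((alpha_bar (Y 0%N) - p%:E) * (p^-1)%:E))%E /\
        limn_einf (log_dev_rate Y (fun n => n%:R * mu + s * n%:R `^ p^-1))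
          = (- ((alpha_low (Y 0%N) - p%:E) * (p^-1)%:E))%E.
  move=> s_gt0; apply: (@log_dev_rate_lim _ _ _ P Y p mu s) => //.
  - apply: (@near_dev_prob_le_of_moments _ _ _ _ _ iidY Y_ge0 _ _ _ p_gt0 s_gt0 2 id) => //.
    + by move: p12 => /andP[].
    + by rewrite -EY expectation_def.
    + by move=> q l c x; exact: truncated_exp_quadratic_le.
    + exact: near_tail_small.
  - move=> b b_gt1.
    have [q q12 [pbq [K K_ge0 momentK]]] : exists2 q : R, 1 <= q <= 2 & p / b < q /\
        exists2 K : R, 0 <= K & (\int[P]_w (Y 0%N w `^ q)%:E <= K%:E)%E.
      by apply: (mean_moment Y_ge0 p_gt0 p12 b_gt1 mu_gt0 EY); exact: near_tail_small.
    apply: (near_dev_prob_ge_of_mean iidY Y_ge0 s p_gt0 b_gt1 q12 pbq EY momentK) => //.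
      exact: ltW.
    exact: near_tail_small.
split=> // s ah s_gt0 _; have [usup uinf] := lims s s_gt0.
exact: cvg_rate_iff p_gt0 usup uinf.
Unshelve. all: by end_near. Qed.
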